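(* Kalton's interlacing graphs $(\mathbb{N}^k,d_{\mathbb{K}})_{k\in\mathbb{N}}$ do not equi-coarsely embed into the James tree space $JT$.
   Context: The James tree space $JT$ is the completion of the finitely supported functions $x:T\to\mathbb{R}$ on the binary tree $T=2^{<\omega}$ under the norm $$\|x\|=\sup\Big(\sum_{j=1}^k\Big|\sum_{t\in S_j}x(t)\Big|^2\Big)^{1/2},$$ where the supremum is over all finite sets of disjoint segments $(S_j)_{j=1}^k$; a segment is a finite interval of a branch in $T$. Kalton graphs: $\mathbb{N}^k$ is the set of strictly increasing $k$-tuples of natural numbers; distinct $\vec n,\vec m\in\mathbb{N}^k$ are joined by an edge if they are interlacing, i.e. $n_1\le m_1\le n_2\le m_2\le\cdots\le n_k\le m_k$ or $m_1\le n_1\le m_2\le n_2\le\cdots\le m_k\le n_k$; $d_{\mathbb{K}}$ is the shortest path metric. A family of metric spaces $(X_k)_k$ equi-coarsely embeds into $Y$ if there are nondecreasing functions $\rho,\omega:[0,\infty)\to[0,\infty)$ with $\lim_{t\to\infty}\rho(t)=\infty$ and maps $\phi_k:X_k\to Y$ with $\rho(d(x,y))\le d(\phi_k(x),\phi_k(y))\le\omega(d(x,y))$ for all $k$ and all $x,y\in X_k$. *)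

(* Defs.v *)
From HB Require Import structures.
From mathcomp Require Import all_boot all_order all_algebra finmap.
From mathcomp Require Import all_classical all_reals all_analysis.
From mathcomp Require Import ring.

Set Implicit Arguments.
Unset Strict Implicit.
Unset Printing Implicit Defensive.

Import Order.TTheory GRing.Theory Num.Theory.
Import numFieldNormedType.Exports.

Local Open Scope classical_set_scope.
Local Open Scope ring_scope.

(* The binary tree 2^{<omega}; the tree order is the prefix order. *)
Notation tree := (seq bool).

(* A branch is given by [b : nat -> bool]; its node at level [i] is the initial
   segment [mkseq b i] of length [i]. The empty segment is allowed: it does not
   change the norm. *)
Definition segment (S : set tree) : Prop :=
  exists (b : nat -> bool) (m n : nat),
    S = [set mkseq b i | i in [set i | (m <= i <= n)%N]].

Section FinitelySupported.
Variable R : realType.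

Definition finsupp : {pred tree -> R^o} :=
  fun x => `[< finite_set [set t | x t != 0] >].

Lemma finsupp_submod_closed : submod_closed finsupp.
Proof.
split=> [|a x y /asboolP fx /asboolP fy]; apply/asboolP.
  suff -> : [set t | (0 : tree -> R^o) t != 0] = set0 by exact: finite_set0.
  by apply/seteqP; split=> t //=; rewrite eqxx.
apply: (@sub_finite_set _ _ ([set t | x t != 0] `|` [set t | y t != 0])).
  move=> t /= h; have [xt0|] := eqVneq (x t) 0; last by left.
  right; apply: contra_neq h => yt0.
  by rewrite [LHS](_ : _ = a *: x t + y t)// xt0 yt0 scaler0 addr0.
by rewrite finite_setU.
Qed.

HB.instance Definition _ := GRing.isSubmodClosed.Build R (tree -> R^o) finsupp
  finsupp_submod_closed.

Record c00 := C00 { c00_fun :> tree -> R^o; _ : c00_fun \in finsupp }.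

HB.instance Definition _ := [isSub for c00_fun].
HB.instance Definition _ := [Choice of c00 by <:].
HB.instance Definition _ := [SubChoice_isSubLmodule of c00 by <:].


Definition jt_sum (x : tree -> R) k (S : 'I_k -> set tree) : R :=
  Num.sqrt (\sum_(j < k) `|\sum_(t \in S j) x t| ^+ 2).

Definition jt_norm (x : tree -> R) : R :=
  sup [set r | exists k (S : 'I_k -> set tree),
    [/\ forall j, segment (S j), trivIset setT S & r = jt_sum x S]].

Lemma segment_finite (S : set tree) : segment S -> finite_set S.
Proof.
move=> [b [m [n ->]]]; apply: finite_image.
by apply: (@sub_finite_set _ _ `I_n.+1) => // i /= /andP[].
Qed.

Lemma segment1 (t : tree) : segment [set t].
Proof.
exists (nth false t), (size t), (size t); apply/seteqP; split=> s /=.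
  by move=> ->; exists (size t); rewrite ?leqnn// mkseq_nth.
by move=> [i]; rewrite -eqn_leq => /eqP <- <-; rewrite mkseq_nth.
Qed.

Lemma cauchy_schwarz_sum k (a b : 'I_k -> R) :
  (\sum_i a i * b i) ^+ 2 <= (\sum_i a i ^+ 2) * (\sum_i b i ^+ 2).
Proof.
set A := \sum_i a i ^+ 2; set B := \sum_i b i ^+ 2; set C := \sum_i _ * _.
have B0 : 0 <= B by apply: sumr_ge0 => i _; exact: sqr_ge0.
have [B_eq0|B_neq0] := eqVneq B 0.
  suff -> : C = 0 by rewrite B_eq0 mulr0 expr0n.
  apply: big1 => i _.
  move/eqP: B_eq0; rewrite psumr_eq0 => [/allP/(_ i)|*]; last exact: sqr_ge0.
  by rewrite mem_index_enum sqrf_eq0 => /(_ isT)/eqP ->; rewrite mulr0.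
have Bp : 0 < B by rewrite lt_def B_neq0.
rewrite -subr_ge0 -(pmulr_rge0 _ Bp).
have -> : B * (A * B - C ^+ 2) = \sum_i (B * a i - C * b i) ^+ 2.
  have E i : (B * a i - C * b i) ^+ 2 = B ^+ 2 * a i ^+ 2
    + - (B * C *+ 2) * (a i * b i) + C ^+ 2 * b i ^+ 2 by ring.
  rewrite (eq_bigr _ (fun i _ => E i)).
  by rewrite !big_split/= -!mulr_sumr -/A -/B -/C; ring.
by apply: sumr_ge0 => i _; exact: sqr_ge0.
Qed.

Lemma minkowski_sum k (a b : 'I_k -> R) :
  Num.sqrt (\sum_i (a i + b i) ^+ 2) <=
  Num.sqrt (\sum_i a i ^+ 2) + Num.sqrt (\sum_i b i ^+ 2).
Proof.
have S0 (c : 'I_k -> R) : 0 <= \sum_i c i ^+ 2.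
  by apply: sumr_ge0 => i _; exact: sqr_ge0.
rewrite -(@ler_pXn2r _ 2) ?nnegrE ?addr_ge0 ?sqrtr_ge0//.
rewrite sqr_sqrtr// sqrrD !sqr_sqrtr// -sqrtrM//.
under eq_bigr do rewrite sqrrD.
rewrite !big_split/= lerD2r lerD2l -mulr2n lerMn2r/=.
rewrite (le_trans (ler_norm _))// -sqrtr_sqr ler_wsqrtr//.
exact: cauchy_schwarz_sum.
Qed.

Lemma jt_sum_ge0 (x : tree -> R) k (S : 'I_k -> set tree) : 0 <= jt_sum x S.
Proof. exact: sqrtr_ge0. Qed.

Lemma jt_sum_le (x : c00) k (S : 'I_k -> set tree) :
    trivIset setT S ->
  jt_sum x S <= \sum_(t <- fset_set [set t | x t != 0]) `|x t|.
Proof.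
move=> dS; set r := fset_set _.
have xr t : t \notin r -> x t = 0.
  have /asboolP fx : (x : tree -> R^o) \in finsupp by case: x {r}.
  by rewrite in_fset_set// => tr; apply/eqP; apply: contraNT tr => xt; exact: mem_set.
pose a j := \sum_(t <- r | t \in S j) `|x t|.
have a0 j : 0 <= a j by exact: sumr_ge0.
have aS j : `|\sum_(t \in S j) x t| <= a j.
  rewrite (fsbigE [seq t <- r | t \in S j]).
  - rewrite big_filter_cond (le_trans (ler_norm_sum _ _ _))// /a.
    by rewrite (eq_bigl (fun t => t \in S j))// => t; rewrite andbb.
  - by rewrite filter_uniq.
  - by move=> t /=; rewrite mem_filter => /andP[]; rewrite inE.
  - move=> t St; rewrite mem_filter negb_and => /orP[|/xr//].
    by rewrite mem_set.
have suma : \sum_j a j <= \sum_(t <- r) `|x t|.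
  rewrite /a (exchange_big_dep xpredT)//=; apply: ler_sum => t _.
  have [j Sj|nS] := pickP (fun j => t \in S j); last first.
    by rewrite big_pred0.
  rewrite (bigD1 j)//= big1 ?addr0// => i /andP[Si /eqP ij].
  exfalso; apply: ij; apply: dS => //; exists t.
  by split; [move: Si|move: Sj]; rewrite inE.
apply: le_trans suma; have sa0 : 0 <= \sum_j a j by exact: sumr_ge0.
rewrite -[leRHS]ger0_norm// -sqrtr_sqr ler_wsqrtr// expr2 mulr_suml.
apply: ler_sum => j _; rewrite (@le_trans _ _ (a j * a j))//.
  by rewrite -expr2 ler_pXn2r ?nnegrE.
by rewrite ler_wpM2l// (bigD1 j)//= lerDl sumr_ge0.
Qed.

(* [jt_norm] is meaningful for such functions only: [sup] is [0] on unbounded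
   sets. *)
Definition jt_bounded (x : tree -> R) : Prop := exists M : R,
  forall k (S : 'I_k -> set tree), (forall j, segment (S j)) ->
    trivIset setT S -> jt_sum x S <= M.

Lemma jt_bounded_c00 (x : c00) : jt_bounded x.
Proof. by eexists => k S _; exact: jt_sum_le. Qed.

Lemma jt_norm_ub (x : tree -> R) k (S : 'I_k -> set tree) : jt_bounded x ->
  (forall j, segment (S j)) -> trivIset setT S -> jt_sum x S <= jt_norm x.
Proof.
move=> [M xM] sS dS; apply: ub_le_sup; last by exists k, S.
by exists M => r [l [S' [sS' dS' ->]]]; exact: xM.
Qed.

Lemma jt_norm_le (x : tree -> R) (M : R) :
  (forall k (S : 'I_k -> set tree), (forall j, segment (S j)) ->
    trivIset setT S -> jt_sum x S <= M) -> jt_norm x <= M.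
Proof.
move=> xM; apply: ge_sup => [|r [k [S [sS dS ->]]]]; last exact: xM.
exists (jt_sum x (fun _ : 'I_0 => set0)), 0%N, (fun=> set0).
by split=> [[]||]//; move=> [].
Qed.

Lemma jt_norm_ge0 (x : tree -> R) : jt_bounded x -> 0 <= jt_norm x.
Proof.
move=> bx; apply: le_trans (jt_sum_ge0 x (fun _ : 'I_0 => set0)) _.
by apply: jt_norm_ub => // [[]//|[]].
Qed.

Lemma jt_sumD (x y : tree -> R) k (S : 'I_k -> set tree) :
  (forall j, segment (S j)) ->
  jt_sum (fun t => x t + y t) S <= jt_sum x S + jt_sum y S.
Proof.
move=> sS; rewrite /jt_sum; under eq_bigr do rewrite real_normK ?num_real//.
under [X in _ <= Num.sqrt X + _]eq_bigr do rewrite real_normK ?num_real//.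
under [X in _ <= _ + Num.sqrt X]eq_bigr do rewrite real_normK ?num_real//.
have E j : \sum_(t \in S j) (x t + y t) =
    \sum_(t \in S j) x t + \sum_(t \in S j) y t.
  by rewrite !fsbig_finite; [rewrite -big_split|exact: segment_finite..].
under eq_bigr do rewrite E.
exact: minkowski_sum.
Qed.

Lemma jt_sumZ (a : R) (x : tree -> R) k (S : 'I_k -> set tree) :
  jt_sum (fun t => a * x t) S = `|a| * jt_sum x S.
Proof.
rewrite /jt_sum -sqrtr_sqr -sqrtrM ?sqr_ge0// mulr_sumr; congr Num.sqrt.
apply: eq_bigr => j _; rewrite -(@real_normK _ a) ?num_real//.
by rewrite -mulr_fsumr normrM exprMn.
Qed.

Lemma jt_boundedD (x y : tree -> R) :
  jt_bounded x -> jt_bounded y -> jt_bounded (fun t => x t + y t).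
Proof.
move=> [M xM] [N yN]; exists (M + N) => k S sS dS.
by apply: le_trans (jt_sumD x y sS) _; rewrite lerD ?xM ?yN.
Qed.

Lemma jt_norm_triangle (x y : tree -> R) : jt_bounded x -> jt_bounded y ->
  jt_norm (fun t => x t + y t) <= jt_norm x + jt_norm y.
Proof.
move=> bx bY; apply: jt_norm_le => k S sS dS.
apply: le_trans (jt_sumD x y sS) _.
by rewrite lerD ?jt_norm_ub.
Qed.

Lemma jt_norm_scale (a : R) (x : tree -> R) : jt_bounded x ->
  jt_norm (fun t => a * x t) = `|a| * jt_norm x.
Proof.
move=> bx; have bax : jt_bounded (fun t => a * x t).
  case: bx => M xM; exists (`|a| * M) => k S sS dS.
  by rewrite jt_sumZ ler_wpM2l ?xM.
apply/eqP; rewrite eq_le; apply/andP; split.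
  apply: jt_norm_le => k S sS dS.
  by rewrite jt_sumZ ler_wpM2l ?jt_norm_ub.
have [->|a0] := eqVneq a 0.
  rewrite normr0 mul0r; apply: jt_norm_ge0; exists 0 => k S sS dS.
  by rewrite jt_sumZ normr0 mul0r.
rewrite -ler_pdivlMl ?normr_gt0//; apply: jt_norm_le => k S sS dS.
by rewrite ler_pdivlMl ?normr_gt0// -jt_sumZ jt_norm_ub.
Qed.

Lemma jt_norm_eval (x : tree -> R) t : jt_bounded x -> `|x t| <= jt_norm x.
Proof.
move=> bx; have <- : jt_sum x (fun _ : 'I_1 => [set t]) = `|x t|.
  by rewrite /jt_sum big_ord1 fsbig_set1 sqrtr_sqr normr_id.
by apply: jt_norm_ub => // [_|i j _ _ _]; [exact: segment1|rewrite !ord1].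
Qed.

Lemma c00_normD (x y : c00) : jt_norm (x + y) <= jt_norm x + jt_norm y.
Proof. by apply: jt_norm_triangle; exact: jt_bounded_c00. Qed.

Lemma c00_normZ (a : R) (x : c00) : jt_norm (a *: x) = `|a| * jt_norm x.
Proof. exact: (jt_norm_scale a (jt_bounded_c00 x)). Qed.

Lemma c00_norm_eq0 (x : c00) : jt_norm x = 0 -> x = 0.
Proof.
move=> x0; apply/val_inj/funext => t; apply/eqP; rewrite -normr_le0 -x0.
exact/jt_norm_eval/jt_bounded_c00.
Qed.

HB.instance Definition _ :=
  Lmodule_isNormed.Build R c00 c00_normD c00_normZ c00_norm_eq0.

Definition is_completion (V : normedModType R) (W : completeNormedModType R)
    (f : {linear V -> W}) : Prop :=
  (forall x, `|f x| = `|x|) /\ dense (range f).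

(* [jt_completion_exists] below shows that [c00] has a completion, realized as a
   space of functions on the tree. *)

Definition jt_approx : {pred tree -> R^o} := fun x =>
  `[< forall e : R, 0 < e -> exists y : c00,
        forall k (S : 'I_k -> set tree), (forall j, segment (S j)) ->
          trivIset setT S -> jt_sum (fun t => x t - y t) S <= e >].

Lemma jt_approx_bounded x : x \in jt_approx -> jt_bounded x.
Proof.
move=> /asboolP/(_ 1 ltr01)[y xy].
have -> : x = (fun t => (x t - y t) + y t) by apply/funext => t; rewrite subrK.
by apply: jt_boundedD (jt_bounded_c00 y); exists 1.
Qed.

Lemma c00_approx (x : c00) : (x : tree -> R^o) \in jt_approx.
Proof.
apply/asboolP => e e0; exists x => k S _ _; rewrite (_ : jt_sum _ _ = 0) ?ltW//.
rewrite /jt_sum big1 ?sqrtr0// => j _.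
by rewrite fsbig1 ?normr0 ?expr0n// => t _; rewrite subrr.
Qed.

Lemma jt_approx_submod_closed : submod_closed jt_approx.
Proof.
split=> [|a x y /asboolP ax /asboolP ay]; first exact: (c00_approx 0).
apply/asboolP => e e0.
have d0 : 0 < e / 2 / (`|a| + 1) by rewrite !divr_gt0// ltr_wpDl.
have [x' xx'] := ax _ d0.
have [y' yy'] := ay (e / 2) (divr_gt0 e0 (ltr0n _ 2)).
exists (a *: x' + y') => k S sS dS.
have -> : (fun t => (a *: x + y) t - (a *: x' + y') t) =
    (fun t => a * (x t - x' t) + (y t - y' t)).
  apply/funext => t.
  rewrite [LHS](_ : _ = a * x t + y t - (a * x' t + y' t))//; ring.
apply: le_trans (jt_sumD _ _ sS) _; rewrite [leRHS](splitr e).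
apply: lerD (yy' _ _ sS dS); rewrite jt_sumZ.
apply: le_trans (ler_wpM2l (normr_ge0 a) (xx' _ _ sS dS)) _.
rewrite mulrCA ger_pMr ?divr_gt0// ler_pdivrMr ?ltr_wpDl// mul1r.
by rewrite lerDl.
Qed.

HB.instance Definition _ := GRing.isSubmodClosed.Build R (tree -> R^o) jt_approx
  jt_approx_submod_closed.

Record jt_fun := JTFun { jt_fun_val :> tree -> R^o;
  jt_funP : jt_fun_val \in jt_approx }.

HB.instance Definition _ := [isSub for jt_fun_val].
HB.instance Definition _ := [Choice of jt_fun by <:].
HB.instance Definition _ := [SubChoice_isSubLmodule of jt_fun by <:].

Lemma jt_bounded_fun (x : jt_fun) : jt_bounded x.
Proof. exact/jt_approx_bounded/jt_funP. Qed.

Lemma jt_fun_normD (x y : jt_fun) : jt_norm (x + y) <= jt_norm x + jt_norm y.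
Proof. by apply: jt_norm_triangle; exact: jt_bounded_fun. Qed.

Lemma jt_fun_normZ (a : R) (x : jt_fun) : jt_norm (a *: x) = `|a| * jt_norm x.
Proof. exact: (jt_norm_scale a (jt_bounded_fun x)). Qed.

Lemma jt_fun_norm_eq0 (x : jt_fun) : jt_norm x = 0 -> x = 0.
Proof.
move=> x0; apply/val_inj/funext => t; apply/eqP; rewrite -normr_le0 -x0.
exact/jt_norm_eval/jt_bounded_fun.
Qed.

HB.instance Definition _ :=
  Lmodule_isNormed.Build R jt_fun jt_fun_normD jt_fun_normZ jt_fun_norm_eq0.

Lemma jt_fun_normE (x : jt_fun) : `|x| = jt_norm x.
Proof. by []. Qed.

Lemma jt_sum_cvg (F : set_system jt_fun) (g : tree -> R) (x : jt_fun)
    k (S : 'I_k -> set tree) : ProperFilter F ->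
  (forall t, (h : jt_fun) t @[h --> F] --> g t) ->
  (forall j, segment (S j)) ->
  jt_sum (fun t => x t - (h : jt_fun) t) S @[h --> F] -->
  jt_sum (fun t => x t - g t) S.
Proof.
move=> PF Fg sS; rewrite /jt_sum.
apply: (continuous_cvg _ (@sqrt_continuous _ _)).
apply: cvg_big => [|j _]; first exact: add_continuous.
apply: (continuous_cvg _ (@exprn_continuous _ 2 _)).
have E (h : tree -> R) : \sum_(t \in S j) (x t - h t) =
    \sum_(t <- fset_set (S j)) (x t - h t).
  by rewrite fsbig_finite//; exact: segment_finite.
apply: cvg_norm; rewrite E; under eq_cvg do rewrite E.
apply: cvg_big => [|t _]; first exact: add_continuous.
by apply: cvgB; [exact: cvg_cst|exact: Fg].
Qed.

Lemma jt_fun_complete (F : set_system jt_fun) :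
  ProperFilter F -> cauchy F -> cvg F.
Proof.
move=> PF /cauchyP cF.
have Fcvg t : cvg ((h : jt_fun) t @[h --> F]).
  apply: cauchy_cvg; apply: cauchy_exP => e e0.
  have [x Fx] := cF e e0; exists (x t).
  suff : F [set h : jt_fun | ball (x t : R^o) e (h t)] by [].
  apply: filterS Fx => h.
  rewrite -!ball_normE/=; apply: le_lt_trans.
  exact: (jt_norm_eval t (jt_bounded_fun (x - h))).
pose g t : R^o := lim ((h : jt_fun) t @[h --> F]).
have Fg t : (h : jt_fun) t @[h --> F] --> g t by exact: Fcvg.
have H (x : jt_fun) (e : R) : F (ball x e) -> forall k (S : 'I_k -> set tree),
    (forall j, segment (S j)) -> trivIset setT S ->
    jt_sum (fun t => x t - g t) S <= e.
  move=> Fx k S sS dS; apply: (cvgr_to_le (@jt_sum_cvg F g x k S PF Fg sS)).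
  near=> h; have : ball x e h by near: h.
  rewrite -ball_normE/= => /ltW; apply: le_trans; rewrite jt_fun_normE.
  exact: (jt_norm_ub (jt_bounded_fun (x - h)) sS dS).
have sym (u v : tree -> R) k (S : 'I_k -> set tree) :
    jt_sum (fun t => u t - v t) S = jt_sum (fun t => v t - u t) S.
  rewrite -[RHS]mul1r -(normrN1 R) -jt_sumZ.
  by congr (jt_sum _ S); apply/funext => t; rewrite mulN1r opprB.
have gP : g \in jt_approx.
  apply/asboolP => e e0.
  have e20 : 0 < e / 2 by rewrite divr_gt0.
  have [x Fx] := cF _ e20.
  have /asboolP/(_ _ e20)[y xy] := jt_funP x.
  exists y => k S sS dS.
  have -> : (fun t => g t - y t) = (fun t => (g t - x t) + (x t - y t)).
    by apply/funext => t; rewrite addrA subrK.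
  apply: le_trans (jt_sumD _ _ sS) _; rewrite [leRHS](splitr e).
  by apply: lerD (xy _ _ sS dS); rewrite sym; exact: H.
apply/cvg_ex; exists (JTFun gP); apply/cvgrPdist_le => e e0.
have e20 : 0 < e / 2 by rewrite divr_gt0.
have [x Fx] := cF _ e20.
near=> h; have xh : ball x (e / 2) h by near: h.
rewrite (le_trans (ler_distD x _ _))// [leRHS](splitr e) lerD//.
  rewrite distrC jt_fun_normE; apply: jt_norm_le => k S sS dS.
  exact: H.
by move: xh; rewrite -ball_normE => /ltW.
Unshelve. all: by end_near. Qed.

HB.instance Definition _ := Uniform_isComplete.Build jt_fun jt_fun_complete.

Definition jt_incl (x : c00) : jt_fun := JTFun (c00_approx x).

Lemma jt_incl_linear : linear jt_incl.
Proof. by move=> a x y; apply/val_inj. Qed.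

HB.instance Definition _ :=
  GRing.isLinear.Build R c00 jt_fun _ jt_incl jt_incl_linear.

Lemma jt_completion_exists :
  exists (JT : completeNormedModType R) (f : {linear c00 -> JT}),
    is_completion f.
Proof.
exists jt_fun, jt_incl; split=> // O [x Ox]; rewrite openE => /(_ _ Ox).
move=> /nbhs_ballP[e /= e0 xO].
have e20 : 0 < e / 2 by rewrite divr_gt0.
have /asboolP/(_ _ e20)[y xy] := jt_funP x.
exists (jt_incl y); split; last by exists y.
apply: xO; rewrite -ball_normE/= (@le_lt_trans _ _ (e / 2))//.
  exact: jt_norm_le.
by rewrite ltr_pdivrMr// ltr_pMr// ltr1n.
Qed.

End FinitelySupported.

Definition kvertex k := {t : k.-tuple nat | sorted ltn t}.

(* [n_1 <= m_1 <= n_2 <= m_2 <= ... <= n_k <= m_k] *)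
Definition interlaced (n m : seq nat) : bool :=
  sorted leq (flatten [seq [:: p.1; p.2] | p <- zip n m]).

Definition kalton_edge k : rel (kvertex k) := fun n m =>
  (n != m) && (interlaced (val n) (val m) || interlaced (val m) (val n)).

Lemma interlaced_shift (x M : nat) (s : seq nat) :
  path leq x s -> (last x s <= M)%N -> interlaced (x :: s) (rcons s M).
Proof.
rewrite /interlaced; elim: s x => [|y s IH] x /=; first by move=> _ ->.
by move=> /andP[-> ys] yM; case: s IH ys yM => [|z s] IH ys yM;
  have := IH _ ys yM; rewrite /= leqnn.
Qed.

Definition kalton_walk k (n m : kvertex k) (p : seq (kvertex k)) : Prop :=
  path (@kalton_edge k) n p /\ last n p = m.

Lemma kalton_walk_trans k (n m q : kvertex k) :
  (exists p, kalton_walk n m p) -> (exists p, kalton_walk m q p) ->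
  exists p, kalton_walk n q p.
Proof.
move=> [p [np <-]] [p' [mp <-]]; exists (p ++ p').
by rewrite /kalton_walk cat_path last_cat np mp.
Qed.

Lemma kalton_walk_sym k (n m : kvertex k) :
  (exists p, kalton_walk n m p) -> exists p, kalton_walk m n p.
Proof.
move=> [p [+ <-]]; elim: p n {m} => [|y p IH] n /=; first by exists [::].
move=> /andP[ny /IH yp]; apply: kalton_walk_trans yp _.
exists [:: n]; split=> //=; rewrite andbT /kalton_edge eq_sym orbC.
exact: ny.
Qed.

Lemma kalton_walk_iota k (n m : kvertex k.+1) M :
  (forall i, (i \in val (val n)) -> (i < M)%N) -> val (val m) = iota M k.+1 ->
  exists p, kalton_walk n m p.
Proof.
move=> nM mM.
have szn : size (val (val n)) = k.+1 by rewrite size_tuple.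
suff: forall j, (j <= k.+1)%N -> forall q : kvertex k.+1,
    val (val q) = drop j (val (val n)) ++ iota M j ->
    exists p, kalton_walk n q p.
  by apply; [exact: leqnn|rewrite mM drop_oversize ?szn].
elim=> [_ q|j IH jk q qE].
  rewrite drop0 cats0 => /val_inj/val_inj ->.
  by exists [::].
pose r := drop j (val (val n)) ++ iota M j.
have szr : size r == k.+1.
  by rewrite size_cat size_drop size_iota szn subnK// ltnW.
have rM i : i \in r -> (i < M + j)%N.
  rewrite mem_cat mem_iota => /orP[/mem_drop/nM|/andP[]//].
  by move=> iM; rewrite ltn_addr.
have sr : sorted ltn r.
  rewrite (sorted_pairwise ltn_trans) pairwise_cat -!(sorted_pairwise ltn_trans).
  apply/and3P; split; last exact: iota_ltn_sorted.
    apply/allrelP => a b /mem_drop/nM aM; rewrite mem_iota => /andP[Mb _].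
    exact: leq_trans aM Mb.
  have sn : sorted ltn (val (val n)) by case: (n).
  by move: sn; apply: drop_sorted => a b c; exact: ltn_trans.
pose v : kvertex k.+1 := exist (fun t : k.+1.-tuple nat => sorted ltn t)
  (Tuple szr) sr.
apply: kalton_walk_trans (IH (ltnW jk) v erefl) _.
exists [:: q]; split=> //=; rewrite andbT /kalton_edge.
have {}qE : val (val q) = rcons (behead r) (M + j).
  have -> : val (val q) = drop j.+1 (val (val n)) ++ rcons (iota M j) (M + j).
    by rewrite qE -[in iota _ _](addn1 j) iotaD cats1.
  by rewrite -rcons_cat /r [drop j _](drop_nth 0%N) ?szn.
apply/andP; split.
  apply: contra_eqN qE => /eqP <-; apply/eqP => rE.
  by have := rM (M + j)%N; rewrite [r]rE mem_rcons mem_head ltnn => /(_ isT).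
apply/orP; left; rewrite qE.
suff H : forall s : seq nat, (0 < size s)%N -> sorted ltn s ->
    (forall i, i \in s -> (i < M + j)%N) ->
    interlaced s (rcons (behead s) (M + j)).
  by apply: (H r) => //; rewrite (eqP szr).
move=> [//|x s] _ /= xs sM.
apply: interlaced_shift; last by apply/ltnW/sM; exact: mem_last.
by apply: sub_path xs => a b; exact: ltnW.
Qed.

Lemma kalton_connected k (n m : kvertex k.+1) : exists p, kalton_walk n m p.
Proof.
pose M := (\max_(i <- val (val n) ++ val (val m)) i).+1.
have sz : size (iota M k.+1) == k.+1 by rewrite size_iota.
pose v : kvertex k.+1 := exist (fun t : k.+1.-tuple nat => sorted ltn t)
  (Tuple sz) (iota_ltn_sorted M k.+1).
have H (q : kvertex k.+1) : {subset val (val q) <= val (val n) ++ val (val m)} ->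
    exists p, kalton_walk q v p.
  move=> qM; apply: (@kalton_walk_iota _ _ _ M) => // i /qM iM.
  by rewrite ltnS; exact: (@leq_bigmax_seq _ _ xpredT id).
apply: (@kalton_walk_trans _ _ v).
  by apply: H => i ni; rewrite mem_cat ni.
by apply/kalton_walk_sym/H => i mi; rewrite mem_cat mi orbT.
Qed.

Lemma kalton_dist_subproof k (n m : kvertex k.+1) :
  exists l, `[< exists2 p, kalton_walk n m p & size p = l >].
Proof.
have [p np] := kalton_connected n m; exists (size p).
by apply/asboolP; exists p.
Qed.

Definition kalton_dist k (n m : kvertex k.+1) : nat :=
  ex_minn (kalton_dist_subproof n m).

(* Only the values of [rho] and [omega] on the nonnegative reals matter. *)
Definition equi_coarsely_embeds (R : realType) (I : Type) (X : I -> Type)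
    (dX : forall i, X i -> X i -> R) (Y : Type) (dY : Y -> Y -> R) : Prop :=
  exists (rho omega : R -> R) (phi : forall i, X i -> Y),
    [/\ forall t, 0 <= t -> 0 <= rho t /\ 0 <= omega t,
        forall s t, 0 <= s -> s <= t -> rho s <= rho t /\ omega s <= omega t,
        rho t @[t --> +oo] --> +oo &
        forall i x y,
          rho (dX i x y) <= dY (phi i x) (phi i y) <= omega (dX i x y)].

(* Main.v *)
Require Import Defs.
From HB Require Import structures.
From mathcomp Require Import all_boot all_order all_algebra finmap.
From mathcomp Require Import all_classical all_reals all_analysis.
From mathcomp Require Import ring lra zify.

Set Implicit Arguments.
Unset Strict Implicit.
Unset Printing Implicit Defensive.

Import Order.TTheory GRing.Theory Num.Theory.
Import numFieldNormedType.Exports.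

Local Open Scope classical_set_scope.
Local Open Scope ring_scope.

(* Kalton's theorem for reflexive spaces pairs a norming functional chosen at one
   vertex with the map at an interlacing vertex and exchanges iterated limits. In
   JT this exchange fails only through the quotient JT**/JT, which is l2 of the
   set of branches: the error is a sum of inner products of boundary values of
   the functionals with elements Z_j of l2, where Z_j measures the mass that the
   j-th coordinate of the map sends to infinity along the branches. The lower
   2-estimate of JT bounds the sum of the ||Z_j||^2 by the Lipschitz constant,
   so for tuples of length s^2 there is a block of s consecutive indices on which
   the sum of the ||Z_j|| is bounded independently of s. Changing the coordinates
   of this block moves a vertex by a distance at least s, but its image by a
   bounded amount only. *)

(** * Limits along ultrafilters *)

Section UltraLimit.
Variable R : realType.

(** Instead of passing to subtuples by Ramsey's theorem, all limits are taken along one nonprincipal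
    ultrafilter: they exist for every bounded function and respect sums and products. Neither the
    dual nor the bidual is formed. Functionals are square-summable combinations of disjoint
    segments, a class that norms the space; vectors are functions with bounded square sums over
    disjoint segments. Both classes are closed under pointwise limits. Since such vectors have small
    tails, pointwise limits of functionals pass through the pairing. Limits of vectors do not: a
    unit bump moving to infinity along a branch tends to 0 pointwise, yet the functional summing
    along this branch sees it. Hence each error term belongs to a limit in some m_j, taken while
    n_1, ..., n_j are fixed. To compare the two ends of a block change, one functional is chosen for
    a tuple of length k + s that contains both vertices as subtuples; the error terms outside the
    block then cancel. *)

Definition bounded_by (T : Type) (B : R) (u : T -> R) := forall x, `|u x| <= B.
Definition bnd (T : Type) (u : T -> R) := exists B, bounded_by B u.

Lemma bnd_cst T (c : R) : bnd (fun _ : T => c).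
Proof. by exists `|c|. Qed.

Lemma bndD T (u v : T -> R) : bnd u -> bnd v -> bnd (fun x => u x + v x).
Proof.
move=> [B uB] [C vC]; exists (B + C) => x.
by rewrite (le_trans (ler_normD _ _))// lerD.
Qed.

Lemma bndN T (u : T -> R) : bnd u -> bnd (fun x => - u x).
Proof. by move=> [B uB]; exists B => x; rewrite normrN. Qed.

Lemma bndB T (u v : T -> R) : bnd u -> bnd v -> bnd (fun x => u x - v x).
Proof. by move=> bu bv; apply: bndD => //; exact: bndN. Qed.

Lemma bndM T (u v : T -> R) : bnd u -> bnd v -> bnd (fun x => u x * v x).
Proof.
move=> [B uB] [C vC]; exists (B * C) => x.
by rewrite normrM ler_pM.
Qed.

Lemma bnd_sum T (I : Type) (r : seq I) (P : pred I) (u : I -> T -> R) :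
  (forall i, P i -> bnd (u i)) -> bnd (fun x => \sum_(i <- r | P i) u i x).
Proof.
move=> bu; elim: r => [|i r IH].
  by exists 0 => x; rewrite big_nil normr0.
have [Pi|nPi] := boolP (P i).
  have [B h] := bndD (bu _ Pi) IH.
  by exists B => x; rewrite big_cons Pi.
by have [B h] := IH; exists B => x; rewrite big_cons (negbTE nPi).
Qed.

Definition ulim T (F : set_system T) (u : T -> R) : R := lim (u x @[x --> F]).

Section Theory.
Context {T : Type} {F : set_system T} {FU : UltraFilter F}.
Implicit Types u v : T -> R.

Let FP : ProperFilter F := ultra_proper.
Local Existing Instance FP.

Lemma ulim_cvg u : bnd u -> u x @[x --> F] --> ulim F u.
Proof.
move=> [B uB]; apply/cvg_ex.
(* Compactness of [[- B, B]] is used in its ultrafilter form. [G] adds nothing to the image of [F],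
   since a preimage or its complement lies in [F]. *)
have [G [GU uG]] := @ultraFilterLemma _ (u x @[x --> F]) _.
have := @segment_compact R (- B) B; rewrite compact_ultra.
move=> /(_ _ GU)[|l [_ Gl]].
  have uF : \forall x \near F, `[- B, B]%classic (u x).
    by apply: nearW => x; rewrite /= in_itv/= -ler_norml.
  exact: uG uF.
exists l => V Vl.
have [//|FV] := in_ultra_setVsetC (u @^-1` V) FU.
have GV : G V by exact: Gl.
have GnV : G (~` V) by exact: uG.
have GP : ProperFilter G by exact: ultra_proper.
have G0 : G (V `&` ~` V) by exact: filterI.
by rewrite setICr in G0; case: (@filter_not_empty _ G _ G0).
Qed.

Lemma ulimE u l : u x @[x --> F] --> l -> ulim F u = l.
Proof. by move=> ul; apply: cvg_lim. Qed.

Lemma ulim_near u v : (\forall x \near F, u x = v x) -> ulim F u = ulim F v.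
Proof.
move=> uv; rewrite /ulim; congr (lim _).
apply/seteqP; split; apply: near_eq_cvg => //.
by apply: filterS uv => x ->.
Qed.

Lemma ulim_cst (c : R) : ulim F (fun=> c) = c.
Proof. by apply: ulimE; exact: cvg_cst. Qed.

Lemma ulim_near_cst u c : (\forall x \near F, u x = c) -> ulim F u = c.
Proof. by move=> /ulim_near->; exact: ulim_cst. Qed.

Lemma ulimD u v : bnd u -> bnd v ->
  ulim F (fun x => u x + v x) = ulim F u + ulim F v.
Proof. by move=> bu bv; apply: ulimE; apply: cvgD; exact: ulim_cvg. Qed.

Lemma ulimB u v : bnd u -> bnd v ->
  ulim F (fun x => u x - v x) = ulim F u - ulim F v.
Proof. by move=> bu bv; apply: ulimE; apply: cvgB; exact: ulim_cvg. Qed.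

Lemma ulimM u v : bnd u -> bnd v ->
  ulim F (fun x => u x * v x) = ulim F u * ulim F v.
Proof. by move=> bu bv; apply: ulimE; apply: cvgM; exact: ulim_cvg. Qed.

Lemma ulimZ c u : bnd u -> ulim F (fun x => c * u x) = c * ulim F u.
Proof. by move=> bu; rewrite ulimM ?ulim_cst//; exact: bnd_cst. Qed.

Lemma ulim_sum (I : Type) (r : seq I) (P : pred I) (u : I -> T -> R) :
  (forall i, P i -> bnd (u i)) ->
  ulim F (fun x => \sum_(i <- r | P i) u i x) =
  \sum_(i <- r | P i) ulim F (u i).
Proof.
move=> bu; elim: r => [|i r IH].
  by rewrite big_nil; apply: ulim_near_cst; apply: nearW => x; rewrite big_nil.
rewrite big_cons; case: ifP => Pi.
  rewrite -IH -ulimD//; [|exact: bu|exact: bnd_sum].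
  by apply: ulim_near; apply: nearW => x; rewrite big_cons Pi.
by rewrite -IH; apply: ulim_near; apply: nearW => x; rewrite big_cons Pi.
Qed.

Lemma ulim_le u c : bnd u -> (\forall x \near F, u x <= c) -> ulim F u <= c.
Proof.
by move=> bu uc; apply: limr_le => //; apply/cvg_ex; eexists; exact: ulim_cvg.
Qed.

Lemma ulim_ge u c : bnd u -> (\forall x \near F, c <= u x) -> c <= ulim F u.
Proof.
by move=> bu uc; apply: limr_ge => //; apply/cvg_ex; eexists; exact: ulim_cvg.
Qed.

Lemma ulim_norm u c : bounded_by c u -> `|ulim F u| <= c.
Proof.
move=> uc; have bu : bnd u by exists c.
rewrite ler_norml; apply/andP; split.
  by apply: ulim_ge => //; apply: nearW => x; have := uc x; rewrite ler_norml => /andP[].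
by apply: ulim_le => //; apply: nearW => x; have := uc x; rewrite ler_norml => /andP[].
Qed.

Lemma bnd_bounded_by u B : bounded_by B u -> bnd u.
Proof. by exists B. Qed.

Lemma ulim_dist u a c : bnd u -> (\forall x \near F, `|u x - a| <= c) ->
  `|ulim F u - a| <= c.
Proof.
move=> bu uc; rewrite ler_distl; apply/andP; split.
  by apply: ulim_ge => //; apply: filterS uc => x; rewrite ler_distl => /andP[].
by apply: ulim_le => //; apply: filterS uc => x; rewrite ler_distl => /andP[].
Qed.

End Theory.
End UltraLimit.

Lemma nat_ultra : exists U : set_system nat, UltraFilter U /\
  (forall n, U [set m | (n < m)%N]).
Proof.
have [U [UU sU]] := @ultraFilterLemma _ (\oo) _.
by exists U; split=> // n; apply: sU; exact: nbhs_infty_gt.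
Qed.

(** Along such a [V] the limit of finite partial sums is the unordered sum; the index set will be
    the uncountable set of branches. *)
Lemma fset_ultra (I : choiceType) : exists V : set_system {fset I},
  UltraFilter V /\ (forall A : {fset I}, V [set B | A `<=` B]%fset).
Proof.
pose G := filter_from setT (fun A : {fset I} => [set B : {fset I} | A `<=` B]%fset).
have GP : ProperFilter G.
  apply: filter_from_proper; last by move=> A _; exists A => /=.
  apply: filter_from_filter; first by exists fset0.
  move=> A B _ _; exists (A `|` B)%fset => // C /=.
  by rewrite fsubUset => /andP[].
have [V [VV sV]] := ultraFilterLemma GP.
by exists V; split=> // A; apply: sV; exists A.
Qed.

(** * Square-summable families *)

Section FiniteSums.
Variable R : realType.

Lemma cauchy_schwarz_seq (J : Type) (r : seq J) (a b : J -> R) :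
  (\sum_(i <- r) a i * b i) ^+ 2 <=
  (\sum_(i <- r) a i ^+ 2) * (\sum_(i <- r) b i ^+ 2).
Proof. by rewrite !(big_tnth _ _ r); exact: cauchy_schwarz_sum. Qed.

Lemma cauchy_schwarz_bound (J : Type) (r : seq J) (a b : J -> R) (B C : R) :
  0 <= B -> 0 <= C ->
  \sum_(i <- r) a i ^+ 2 <= B ^+ 2 -> \sum_(i <- r) b i ^+ 2 <= C ^+ 2 ->
  `|\sum_(i <- r) a i * b i| <= B * C.
Proof.
move=> B0 C0 aB bC; rewrite -(@ler_pXn2r _ 2) ?nnegrE ?mulr_ge0//.
rewrite real_normK ?num_real// (le_trans (cauchy_schwarz_seq _ _ _))//.
by rewrite exprMn ler_pM// sumr_ge0// => i _; exact: sqr_ge0.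
Qed.

Lemma sum_fset_split (I : choiceType) (A B : {fset I}) (F : I -> R) :
  (A `<=` B)%fset ->
  \sum_(i <- B) F i = \sum_(i <- A) F i + \sum_(i <- (B `\` A)%fset) F i.
Proof.
move=> AB; rewrite -big_cat; apply: perm_big; apply: uniq_perm.
- exact: fset_uniq.
- rewrite cat_uniq !fset_uniq/= andbT; apply/hasPn => i.
  by rewrite inE => /andP[].
- move=> i; rewrite mem_cat inE; have [iA|//] := boolP (i \in A).
  by rewrite (fsubsetP AB).
Qed.

End FiniteSums.

Section SquareSummable.
Variables (R : realType) (I : choiceType) (V : set_system {fset I}).
Context {VU : UltraFilter V}.
Hypothesis Vsub : forall A : {fset I}, V [set B | A `<=` B]%fset.
Implicit Types (y z : I -> R) (A : {fset I}).

Let VP : ProperFilter V := ultra_proper.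
Local Existing Instance VP.

Definition sqb (B : R) y := forall A, \sum_(i <- A) y i ^+ 2 <= B ^+ 2.

Lemma sqb_tail B z e : sqb B z -> 0 < e ->
  exists A0, forall A, (A0 `<=` A)%fset ->
    \sum_(i <- (A `\` A0)%fset) z i ^+ 2 <= e ^+ 2.
Proof.
move=> zB e0; pose E := [set \sum_(i <- A) z i ^+ 2 | A in [set: {fset I}]].
have Esup : has_sup E.
  split; first by exists (\sum_(i <- fset0) z i ^+ 2), fset0.
  by exists (B ^+ 2) => _ [A _ <-].
have e20 : 0 < e ^+ 2 by rewrite exprn_gt0.
have [_ [A0 _ <-] hA0] := sup_adherent e20 Esup.
exists A0 => A A0A.
have : \sum_(i <- A) z i ^+ 2 <= sup E.
  by apply: (sup_upper_bound Esup); exists A.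
rewrite (sum_fset_split _ A0A) => h.
by move: h hA0; set u := \sum_(_ <- _) _; set v := \sum_(_ <- _) _; lra.
Qed.

Lemma sqb_bnd B y : 0 <= B -> sqb B y -> forall i, `|y i| <= B.
Proof.
move=> B0 yB i; rewrite -(@ler_pXn2r _ 2) ?nnegrE// real_normK ?num_real//.
by have := yB [fset i]%fset; rewrite big_seq_fset1.
Qed.

(** Each condition in [sqb] concerns a finite sum, through which the limit passes: balls of l2 are
    weakly closed. *)
Lemma sqb_ulim T (F : set_system T) {FU : UltraFilter F} (B : R) (y : T -> I -> R) :
  0 <= B -> (forall n, sqb B (y n)) -> sqb B (fun i => ulim F (y^~ i)).
Proof.
move=> B0 yB A.
have by_ i : bnd (y^~ i) by exists B => n; exact: sqb_bnd.
rewrite (eq_bigr (fun i => ulim F (fun n => y n i ^+ 2))); last first.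
  by move=> i _; rewrite expr2 -ulimM.
rewrite -ulim_sum; last by move=> i _; apply: bndM.
have FP : ProperFilter F := ultra_proper.
apply: ulim_le; last by apply: nearW => n; exact: yB.
by apply: bnd_sum => i _; apply: bndM.
Qed.

Lemma sqbW B C y : 0 <= B -> B <= C -> sqb B y -> sqb C y.
Proof.
move=> B0 BC yB A; apply: le_trans (yB A) _.
by rewrite ler_pXn2r// nnegrE// (le_trans B0).
Qed.

Lemma sqbD B C y z : 0 <= B -> 0 <= C -> sqb B y -> sqb C z ->
  sqb (B + C) (fun i => y i + z i).
Proof.
move=> B0 C0 yB zC A.
under eq_bigr do rewrite sqrrD.
rewrite !big_split/= sqrrD; apply: lerD (zC A); apply: lerD (yB A) _.
rewrite -mulr2n lerMn2r/=; apply: le_trans (ler_norm _) _.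
exact: cauchy_schwarz_bound.
Qed.

Lemma sqbZ B c y : sqb B y -> sqb (`|c| * B) (fun i => c * y i).
Proof.
move=> yB A; under eq_bigr do rewrite exprMn.
rewrite -mulr_sumr exprMn real_normK ?num_real// ler_wpM2l ?sqr_ge0//.
Qed.

(** The inner product of l2. As a limit along [V] it needs no proof of summability. *)
Definition l2_pair y z := ulim V (fun A => \sum_(i <- A) y i * z i).

Lemma pairC y z : l2_pair y z = l2_pair z y.
Proof.
by congr ulim; apply/funext => A; apply: eq_bigr => i _; rewrite mulrC.
Qed.

Section Bounds.
Variables (B C : R) (B0 : 0 <= B) (C0 : 0 <= C).

Lemma pair_bnd y z : sqb B y -> sqb C z ->
  bounded_by (B * C) (fun A => \sum_(i <- A) y i * z i).
Proof. by move=> yB zC A; exact: cauchy_schwarz_bound. Qed.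

Lemma pair_norm y z : sqb B y -> sqb C z -> `|l2_pair y z| <= B * C.
Proof. by move=> yB zC; apply: ulim_norm; exact: pair_bnd. Qed.

Lemma pairDl y y' z : sqb B y -> sqb B y' -> sqb C z ->
  l2_pair (fun i => y i + y' i) z = l2_pair y z + l2_pair y' z.
Proof.
move=> yB y'B zC; rewrite /l2_pair -ulimD; last 2 first.
- exact/bnd_bounded_by/pair_bnd.
- exact/bnd_bounded_by/pair_bnd.
congr ulim; apply/funext => A; rewrite -big_split/=.
by apply: eq_bigr => i _; rewrite mulrDl.
Qed.

Lemma pairZl c y z : sqb B y -> sqb C z ->
  l2_pair (fun i => c * y i) z = c * l2_pair y z.
Proof.
move=> yB zC; rewrite /l2_pair -ulimZ; last exact/bnd_bounded_by/pair_bnd.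
congr ulim; apply/funext => A; rewrite mulr_sumr.
by apply: eq_bigr => i _; rewrite mulrA.
Qed.

Lemma pair_tail y z e A0 : sqb B y -> sqb C z -> 0 <= e ->
  (forall A, (A0 `<=` A)%fset ->
    \sum_(i <- (A `\` A0)%fset) z i ^+ 2 <= e ^+ 2) ->
  `|l2_pair y z - \sum_(i <- A0) y i * z i| <= B * e.
Proof.
move=> yB zC e0 ze; apply: ulim_dist.
  exact/bnd_bounded_by/pair_bnd.
apply: filterS (Vsub A0) => A /= A0A.
rewrite (sum_fset_split _ A0A) addrC addKr.
by apply: cauchy_schwarz_bound => //; exact: ze.
Qed.

(** Bounded coordinatewise convergence is weak convergence: outside a finite set [A0] the fixed
    vector [z] is small, uniformly in [n]. *)
Lemma pair_ulim T (F : set_system T) {FU : UltraFilter F} (y : T -> I -> R) z :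
  (forall n, sqb B (y n)) -> sqb C z ->
  ulim F (fun n => l2_pair (y n) z) = l2_pair (fun i => ulim F (y^~ i)) z.
Proof.
move=> yB zC; apply/eqP; rewrite -subr_eq0 -normr_le0.
apply/ler_addgt0Pl => e e0; rewrite addr0.
(* Both sides differ from the limit of the finite sums by at most [B * d]; the [+ 1] covers
   [B = 0]. *)
pose d := e / (2 * (B + 1)).
have B1 : 0 < B + 1 by rewrite ltr_wpDl.
have d0 : 0 < d by rewrite divr_gt0// mulr_gt0.
have [A0 hA0] := sqb_tail zC d0.
have by_ i : bnd (y^~ i) by exists B => n; exact: sqb_bnd.
have bp : bnd (fun n => l2_pair (y n) z).
  by exists (B * C) => n; exact: pair_norm.
have bs i : bnd (fun n => y n i * z i) by apply: bndM => //; exact: bnd_cst.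
have E : \sum_(i <- A0) ulim F (y^~ i) * z i =
    ulim F (fun n => \sum_(i <- A0) y n i * z i).
  rewrite ulim_sum//; apply: eq_bigr => i _.
  by rewrite ulimM ?ulim_cst//; exact: bnd_cst.
have h1 : `|ulim F (fun n => l2_pair (y n) z)
    - ulim F (fun n => \sum_(i <- A0) y n i * z i)| <= B * d.
  rewrite -ulimB//; last exact: bnd_sum.
  by apply: ulim_norm => n; apply: pair_tail => //; exact: ltW.
have h2 : `|l2_pair (fun i => ulim F (y^~ i)) z
    - ulim F (fun n => \sum_(i <- A0) y n i * z i)| <= B * d.
  by rewrite -E; apply: pair_tail => //; [exact: sqb_ulim|exact: ltW].
have {h1 h2} := lerD h1 h2.
rewrite [X in _ + X]distrC => h; apply: le_trans (ler_distD _ _ _) _.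
apply: le_trans h _; rewrite /d -mulrDl.
have -> : (B + B) * (e / (2 * (B + 1))) = e * (B / (B + 1)).
  by field; rewrite gt_eqF.
by rewrite ger_pMr// ler_pdivrMr// mul1r lerDl.
Qed.

End Bounds.

Lemma pair_delta C i z : 0 <= C -> sqb C z -> l2_pair (fun j => (j == i)%:R) z = z i.
Proof.
move=> C0 zC; apply: ulim_near_cst.
apply: filterS (Vsub [fset i]%fset) => A /=; rewrite fsub1set => iA.
rewrite (bigD1_seq i)//= eqxx mul1r big1 ?addr0// => j /negbTE->.
by rewrite mul0r.
Qed.

Lemma pair_sqr_le C y z : 0 <= C -> sqb 1 y -> sqb C z ->
  `|l2_pair y z| <= Num.sqrt (l2_pair z z).
Proof.
move=> C0 y1 zC; rewrite -sqrtr_sqr ler_wsqrtr// expr2.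
have b1 := bnd_bounded_by (pair_bnd ler01 C0 y1 zC).
have b2 := bnd_bounded_by (pair_bnd C0 C0 zC zC).
rewrite /l2_pair -ulimM// -subr_ge0 -ulimB//; last exact: bndM.
apply: ulim_ge; first by apply: bndB => //; exact: bndM.
apply: nearW => A; rewrite subr_ge0 -expr2.
apply: le_trans (cauchy_schwarz_seq _ _ _) _.
rewrite [leRHS](eq_bigr (fun i => z i ^+ 2)); last by move=> i; rewrite expr2.
rewrite -[leRHS]mul1r ler_wpM2r ?sumr_ge0//; first by move=> i _; exact: sqr_ge0.
by rewrite (le_trans (y1 A))// expr1n.
Qed.

End SquareSummable.

(** * Bounded elements *)

Lemma sqb_seq (R : realType) (I : choiceType) (B : R) (y : I -> R) (r : seq I) :
  sqb B y -> uniq r -> \sum_(i <- r) y i ^+ 2 <= B ^+ 2.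
Proof.
move=> yB ur; have := yB [fset i in r]%fset.
rewrite (_ : \sum_(i <- [fset i in r]%fset) _ = \sum_(i <- r) y i ^+ 2)//.
by apply: perm_big; apply: uniq_perm => // i; rewrite inE.
Qed.

Lemma mkseq_nthE (t : tree) i : (i <= size t)%N ->
  mkseq (nth false t) i = take i t.
Proof. by move=> it; rewrite /mkseq map_nth_iota0. Qed.

Section TreeSums.
Variable R : realType.
Implicit Types (x : tree -> R) (g : nat -> bool).

(** The nodes of height at most [h] form the finite type [h.-bseq bool], so that sums over nodes can
    be exchanged. *)
Lemma fsbig_bseq (A : set tree) h x : (forall t, A t -> (size t <= h)%N) ->
  \sum_(t \in A) x t = \sum_(t : h.-bseq bool) (bseqval t \in A)%:R * x t.
Proof.
move=> Ah; pose r := [seq t <- [seq (bseqval t) | t : h.-bseq bool] | t \in A].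
have ur : uniq r.
  by rewrite filter_uniq// map_inj_uniq ?enum_uniq//; exact: val_inj.
rewrite (@fsbigE _ _ _ _ _ r)//; last 2 first.
- by move=> t /=; rewrite mem_filter => /andP[]; rewrite inE.
- move=> t At; rewrite mem_filter mem_set//= => /negP[].
  by apply/mapP; exists (Bseq (Ah _ At)); rewrite ?mem_enum.
rewrite big_filter_cond big_map big_enum_cond/= big_mkcond/=.
apply: eq_bigr => t _; rewrite andbb.
by case: ifPn => // _; rewrite ?mul1r ?mul0r.
Qed.

Lemma segment_sum x g m n :
  \sum_(t \in [set mkseq g i | i in [set i | (m <= i <= n)%N]]) x t =
  \sum_(m <= i < n.+1) x (mkseq g i).
Proof.
rewrite (@fsbigE _ _ _ _ _ [seq mkseq g i | i <- index_iota m n.+1]).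
- rewrite big_map big_seq_cond [RHS]big_seq_cond; apply: eq_bigl => i.
  rewrite mem_index_iota ltnS; case: (boolP (m <= i <= n)%N) => //= imn.
  by rewrite mem_set//; exists i.
- rewrite map_inj_uniq ?iota_uniq// => i j /(congr1 size).
  by rewrite !size_mkseq.
- move=> t /= /mapP[i]; rewrite mem_index_iota ltnS => imn ->.
  by exists i.
- move=> t /= [i /= imn it] /negP[]; rewrite -it; apply/map_f.
  by rewrite mem_index_iota ltnS.
Qed.

(** The ball of radius [C], stated without a supremum. By [jtb_tail] its elements are norm limits of
    their truncations, so pointwise limits of bounded sequences remain in JT. *)
Definition jtb (C : R) x := forall k (S : 'I_k -> set tree),
  (forall j, segment (S j)) -> trivIset setT S ->
  \sum_j (\sum_(t \in S j) x t) ^+ 2 <= C ^+ 2.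

Lemma jt_sum_sqr x k (S : 'I_k -> set tree) :
  jt_sum x S ^+ 2 = \sum_j (\sum_(t \in S j) x t) ^+ 2.
Proof.
rewrite /jt_sum sqr_sqrtr; last by apply: sumr_ge0 => j _; exact: sqr_ge0.
by apply: eq_bigr => j _; rewrite real_normK ?num_real.
Qed.

Lemma jtb_jt_norm C x : jt_bounded x -> jt_norm x <= C -> jtb C x.
Proof.
move=> bx xC k S sS dS; rewrite -jt_sum_sqr ler_pXn2r// ?nnegrE.
- exact: le_trans (jt_norm_ub bx sS dS) xC.
- exact: jt_sum_ge0.
- exact: le_trans (jt_norm_ge0 bx) xC.
Qed.

Lemma jtb_path C x g m n : 0 <= C -> jtb C x ->
  `|\sum_(m <= i < n) x (mkseq g i)| <= C.
Proof.
move=> C0 xC; case: n => [|n]; first by rewrite big_geq// normr0.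
rewrite -(@ler_pXn2r _ 2) ?nnegrE// real_normK ?num_real//.
rewrite -segment_sum.
have := xC 1%N (fun=> [set mkseq g i | i in [set i | (m <= i <= n)%N]]).
rewrite big_ord1; apply; first by move=> _; exists g, m, n.
by move=> i j _ _ _; rewrite !ord1.
Qed.

Lemma jtb_eval C x t : 0 <= C -> jtb C x -> `|x t| <= C.
Proof.
move=> C0 xC; have := jtb_path (nth false t) (size t) (size t).+1 C0 xC.
by rewrite big_nat1 mkseq_nth.
Qed.

Lemma fsbig_seg_sum (S : set tree) x : segment S ->
  \sum_(t \in S) x t = \sum_(t <- fset_set S) x t.
Proof. by move=> sS; rewrite fsbig_finite//; exact: segment_finite. Qed.

Lemma jtb_ulim T (F : set_system T) {FU : UltraFilter F} C (x : T -> tree -> R) :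
  0 <= C -> (forall n, jtb C (x n)) -> jtb C (fun t => ulim F (x^~ t)).
Proof.
move=> C0 xC k S sS dS.
have bx t : bnd (x^~ t) by exists C => n; exact: jtb_eval.
have bs j : bnd (fun n => \sum_(t <- fset_set (S j)) x n t).
  by apply: bnd_sum => t _.
rewrite (eq_bigr (fun j => ulim F (fun n =>
    (\sum_(t <- fset_set (S j)) x n t) ^+ 2))); last first.
  by move=> j _; rewrite expr2 ulimM// ulim_sum// fsbig_seg_sum.
rewrite -ulim_sum; last by move=> j _; exact: bndM.
have FP : ProperFilter F := ultra_proper.
apply: ulim_le; first by apply: bnd_sum => j _; exact: bndM.
apply: nearW => n; apply: le_trans (xC n k S sS dS).
by apply: ler_sum => j _; rewrite fsbig_seg_sum.
Qed.

Lemma jtbD B C x y : 0 <= B -> 0 <= C -> jtb B x -> jtb C y ->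
  jtb (B + C) (fun t => x t + y t).
Proof.
move=> B0 C0 xB yC k S sS dS; rewrite -jt_sum_sqr ler_pXn2r ?nnegrE ?addr_ge0//.
  apply: le_trans (jt_sumD x y sS) _; apply: lerD.
    by rewrite -(@ler_pXn2r _ 2) ?nnegrE ?jt_sum_ge0// jt_sum_sqr; exact: xB.
  by rewrite -(@ler_pXn2r _ 2) ?nnegrE ?jt_sum_ge0// jt_sum_sqr; exact: yC.
exact: jt_sum_ge0.
Qed.

Lemma jtbN B x : jtb B x -> jtb B (fun t => - x t).
Proof.
move=> xB k S sS dS; apply: le_trans (xB k S sS dS).
by apply: ler_sum => j _; rewrite !fsbig_seg_sum// sumrN sqrrN.
Qed.

Lemma jtbB B C x y : 0 <= B -> 0 <= C -> jtb B x -> jtb C y ->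
  jtb (B + C) (fun t => x t - y t).
Proof. by move=> B0 C0 xB /jtbN yC; exact: jtbD. Qed.

Definition above h x : tree -> R := fun t => if (h <= size t)%N then x t else 0.

Lemma segment_above h (S : set tree) : segment S ->
  segment (S `&` [set t | (h <= size t)%N]).
Proof.
move=> [g [m [n ->]]]; exists g, (maxn m h), n; apply/seteqP; split.
  move=> t [[i /= /andP[mi iN] <-]]; rewrite size_mkseq => hi.
  by exists i; rewrite //= geq_max mi hi.
move=> t [i /=]; rewrite geq_max => /andP[/andP[mi hi] iN] <-.
by split; [exists i; rewrite //= mi|rewrite /= size_mkseq].
Qed.

Lemma segment_height k (S : 'I_k -> set tree) : (forall j, segment (S j)) ->
  exists h, forall j t, S j t -> (size t < h)%N.
Proof.
move=> sS; have /choice[h hh] : forall j, exists h : nat,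
    forall t, S j t -> (size t < h)%N.
  move=> j; have [g [m [n ->]]] := sS j.
  by exists n.+1 => _ [i /= /andP[_ iN] <-]; rewrite size_mkseq.
exists (\max_j h j) => j t Sjt.
by apply: leq_trans (hh _ _ Sjt) _; exact: leq_bigmax.
Qed.

(* Otherwise one could stack arbitrarily many disjoint families, each of energy
   at least [e ^+ 2], on top of each other. *)
Lemma jtb_tail C x e : jtb C x -> 0 < e -> exists h, jtb e (above h x).
Proof.
move=> xC e0; apply: contrapT => nh.
have H (K : nat) : exists h k (S : 'I_k -> set tree), [/\
    forall j, segment (S j), trivIset setT S,
    forall j t, S j t -> (size t < h)%N &
    K%:R * e ^+ 2 <= \sum_j (\sum_(t \in S j) x t) ^+ 2].
  elim: K => [|K [h [k [S [sS dS Sh hS]]]]].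
    exists 0%N, 0%N, (fun=> set0); split=> [[]//|[]//|[]//|].
    by rewrite mul0r big_ord0.
  have : ~ jtb e (above h x) by move=> ?; apply: nh; exists h.
  move=> /existsNP[k' /existsNP[S1 /not_implyP[sS1 /not_implyP[dS1]]]].
  move/negP; rewrite -ltNge => hS1.
  pose S' j := S1 j `&` [set t | (h <= size t)%N].
  have sS' j : segment (S' j) by exact: segment_above.
  have [h' hh'] := segment_height sS'.
  pose T (j : 'I_(k + k')) := match fintype.split j with
    inl a => S a | inr a => S' a end.
  exists (maxn h h'), (k + k')%N, T; split.
  - by move=> j; rewrite /T; case: fintype.split.
  - move=> i j _ _ [t]; rewrite /T -[in RHS](splitK j) -[in LHS](splitK i).
    case: fintype.split => a; case: fintype.split => b /= [Ta Tb].
    + by congr (unsplit (inl _)); apply: dS => //; exists t.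
    + by have := Sh _ _ Ta; case: Tb => _ /= /leq_ltn_trans h1 /h1; rewrite ltnn.
    + by have := Sh _ _ Tb; case: Ta => _ /= /leq_ltn_trans h1 /h1; rewrite ltnn.
    + congr (unsplit (inr _)); apply: dS1 => //.
      by exists t; split; [case: Ta|case: Tb].
  - move=> j t; rewrite /T; case: fintype.split => a; rewrite leq_max.
      by move=> /Sh ->.
    by move=> /hh' ->; rewrite orbT.
  - rewrite -natr1 mulrDl mul1r big_split_ord/=; apply: lerD.
      apply: le_trans hS _; rewrite le_eqVlt; apply/orP; left; apply/eqP.
      by apply: eq_bigr => j _; rewrite /T (unsplitK (inl j)).
    apply: le_trans (ltW hS1) _; rewrite le_eqVlt; apply/orP; left; apply/eqP.
    apply: eq_bigr => j _; rewrite /T (unsplitK (inr j)); congr (_ ^+ 2).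
    transitivity (\sum_(t \in S' j) above h x t).
      apply/esym/fsbig_widen; first by move=> t [].
      by move=> t [S1t] /not_andP[//|/= /negP /negbTE ht]; rewrite /above ht.
    by apply: eq_fsbigr => t; rewrite inE => -[_ /= ht]; rewrite /above ht.
have e20 : 0 < e ^+ 2 by rewrite exprn_gt0.
pose K := (Num.truncn (C ^+ 2 / e ^+ 2)).+1.
have [h [k [S [sS dS _]]]] := H K.
apply/negP; rewrite -ltNge; apply: le_lt_trans (xC k S sS dS) _.
by rewrite -ltr_pdivrMr// truncnS_gt.
Qed.

End TreeSums.

(** * Functionals carried by disjoint segments *)

Section SegmentSystems.
Variable R : realType.
Implicit Types (x b phi : tree -> R) (S : tree -> tree -> bool) (s t : tree).

(* [S s] is the (possibly empty or infinite) segment of the system that starts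
   at the node [s]; indexing by the first node makes pointwise limits of systems
   meaningful. *)
Definition seg_system S := [/\
  forall s t, S s t -> prefix s t,
  forall s t i, S s t -> (size s <= i)%N -> S s (take i t),
  forall s t t', S s t -> S s t' -> (size t <= size t')%N ->
    t = take (size t) t' &
  forall s s' t, S s t -> S s' t -> s = s'].

(** The sum over [s] of [b s] times the indicator of [S s]: a concrete part of the dual ball of
    radius [B], explicit enough for its boundary values to be seen to lie in l2. *)
Definition in_dual (B : R) phi := exists b S, [/\ seg_system S, sqb B b,
  forall s t, S s t -> phi t = b s &
  forall t, (forall s, ~~ S s t) -> phi t = 0].

Definition trunc_pair phi x h : R := \sum_(t : h.-bseq bool) phi t * x t.

Lemma sum_sqb_bseq B b h : sqb B b -> \sum_(s : h.-bseq bool) b s ^+ 2 <= B ^+ 2.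
Proof.
move=> bB; have := sqb_seq bB (r := [seq (bseqval t) | t : h.-bseq bool]).
rewrite big_map big_enum/=; apply.
by rewrite map_inj_uniq ?enum_uniq//; exact: val_inj.
Qed.


Lemma seg_system_segment S s h : seg_system S ->
  segment [set t | S s t /\ (size t <= h)%N].
Proof.
move=> [pS cS hS uS].
pose P n := `[< exists t, [/\ S s t, size t = n & (n <= h)%N] >].
have Ph n : P n -> (n <= h)%N by move=> /asboolP[t []].
have [exP|nP] := pselect (exists n, P n); last first.
  (* The bounds 1 and 0 encode the empty segment. *)
  exists (fun=> false), 1%N, 0%N; apply/seteqP; split.
    move=> t [St th]; exfalso; apply: nP; exists (size t).
    by apply/asboolP; exists t.
  by move=> t [i /= /andP[i1 i0]]; have := leq_trans i1 i0.
have [n /asboolP[u [Su un nh]] umax] := ex_maxnP exP Ph.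
exists (nth false u), (size s), n; apply/seteqP; split=> t.
  move=> [St th]; have tn : (size t <= n)%N.
    by apply: umax; apply/asboolP; exists t.
  exists (size t) => /=; first by rewrite tn andbT size_prefix// pS.
  by rewrite mkseq_nthE ?un// -(hS _ _ _ St Su)// un.
move=> [i /= /andP[si iN] <-]; rewrite mkseq_nthE ?un//; split.
  exact: cS.
by rewrite size_takel ?un// (leq_trans iN).
Qed.

Lemma seg_system_jtb S C x h : seg_system S -> jtb C x ->
  \sum_(s : h.-bseq bool)
    (\sum_(t : h.-bseq bool) (S s t)%:R * x t) ^+ 2 <= C ^+ 2.
Proof.
move=> sS xC.
pose T (j : 'I_#|{: h.-bseq bool}|) :=
  [set t | S (enum_val j : h.-bseq bool) t /\ (size t <= h)%N].
have sT j : segment (T j) by exact: seg_system_segment.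
have dT : trivIset setT T.
  move=> i j _ _ [t [[Si _] [Sj _]]]; case: sS => _ _ _ uS.
  by apply/enum_val_inj/val_inj; exact: uS Si Sj.
apply: le_trans (xC _ T sT dT); rewrite le_eqVlt; apply/orP; left; apply/eqP.
rewrite (reindex (@enum_val _ {: h.-bseq bool}))/=; last first.
  exact/onW_bij/enum_val_bij.
apply: eq_bigr => j _; congr (_ ^+ 2).
rewrite (@fsbig_bseq _ _ h); last by move=> t [].
apply: eq_bigr => t _; congr (_%:R * _); congr nat_of_bool.
by apply/idP/idP => [St|]; [rewrite mem_set//; split=> //; exact: size_bseq|
  rewrite inE => -[]].
Qed.

Lemma in_dual_expand S b phi h (t : h.-bseq bool) : seg_system S ->
  (forall s t, S s t -> phi t = b s) ->
  (forall t, (forall s, ~~ S s t) -> phi t = 0) ->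
  phi t = \sum_(s : h.-bseq bool) (S s t)%:R * b s.
Proof.
move=> [pS cS hS uS] phib phi0.
have [[s Sst]|nS] := pselect (exists s, S s t); last first.
  rewrite phi0 => [|s]; last by apply/negP => Sst; apply: nS; exists s.
  rewrite big1// => s _; rewrite (_ : S s t = false) ?mul0r//.
  by apply/negP => Sst; apply: nS; exists s.
have sh : (size s <= h)%N.
  by rewrite (leq_trans (size_prefix (pS _ _ Sst)))// size_bseq.
rewrite (phib s)// (bigD1 (Bseq sh))//= Sst mul1r big1 ?addr0// => s' s's.
rewrite (_ : S s' t = false) ?mul0r//; apply/negP => Ss't.
by move/negP: s's; apply; apply/eqP/val_inj; exact: uS Ss't Sst.
Qed.

(** After grouping the nodes by segments, this is Cauchy-Schwarz between the coefficients and the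
    sums of [x] over disjoint segments. *)
Lemma trunc_pair_bound B C phi x h : 0 <= B -> 0 <= C -> in_dual B phi ->
  jtb C x -> `|trunc_pair phi x h| <= B * C.
Proof.
move=> B0 C0 [b [S [sS bB phib phi0]]] xC.
have -> : trunc_pair phi x h = \sum_(s : h.-bseq bool)
    b s * (\sum_(t : h.-bseq bool) (S s t)%:R * x t).
  rewrite /trunc_pair; under eq_bigr => t _ do
    rewrite (in_dual_expand t sS phib phi0) mulr_suml.
  rewrite exchange_big/=; apply: eq_bigr => s _; rewrite mulr_sumr.
  by apply: eq_bigr => t _; rewrite mulrAC mulrC.
apply: cauchy_schwarz_bound => //; first exact: sum_sqb_bseq.
exact: seg_system_jtb.
Qed.

Lemma in_dual_eval B phi t : 0 <= B -> in_dual B phi -> `|phi t| <= B.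
Proof.
move=> B0 [b [S [sS bB phib phi0]]].
have [[s Sst]|nS] := pselect (exists s, S s t).
  by rewrite (phib s)//; exact: sqb_bnd.
rewrite phi0 ?normr0// => s; apply/negP => Sst; apply: nS; by exists s.
Qed.

(** A segment has at most one node at level [n], so each [b s ^+ 2] is counted at most once. *)
Lemma in_dual_level B phi (r : seq tree) n : 0 <= B -> in_dual B phi ->
  uniq r -> (forall t, t \in r -> size t = n) ->
  \sum_(t <- r) phi t ^+ 2 <= B ^+ 2.
Proof.
move=> B0 [b [S [sS bB phib phi0]]] ur rn.
have expand t : t \in r -> phi t ^+ 2 =
    \sum_(s : n.-bseq bool) (S s t)%:R * b s ^+ 2.
  move=> tr; have tn : (size t <= n)%N by rewrite rn.
  have phi20 u : (forall s, ~~ S s u) -> phi u ^+ 2 = 0.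
    by move=> /phi0 ->; rewrite expr0n.
  have phi2b s u : S s u -> phi u ^+ 2 = b s ^+ 2 by move=> /phib ->.
  (* The square of [phi] is again constant on the segments, with coefficients [b s ^+ 2]. *)
  exact: (@in_dual_expand S (fun s => b s ^+ 2) (fun t => phi t ^+ 2) n
    (Bseq tn) sS phi2b phi20).
rewrite big_seq (eq_bigr _ expand) -big_seq exchange_big/=.
apply: le_trans (sum_sqb_bseq n bB); apply: ler_sum => s _.
rewrite -mulr_suml ler_piMl ?sqr_ge0//.
case: sS => _ _ hS _; have [/hasP[t tr Sst]|/hasPn nS] := boolP (has (S s) r).
  rewrite (bigD1_seq t)//= Sst big_seq_cond big1 ?addr0// => t' /andP[t'r t't].
  rewrite (_ : S s t' = false)//; apply/negP => Sst'.
  move/negP: t't; apply; apply/eqP.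
  by rewrite (hS _ _ _ Sst' Sst) !rn// -(rn _ tr) take_size.
by rewrite big_seq big1// => t /nS /negbTE ->.
Qed.

(** A substitute for weak-star compactness. Each axiom of [seg_system] involves at most two
    memberships, which hold for a common [n], and the coefficients converge by [sqb_ulim]. *)
Lemma in_dual_ulim T (F : set_system T) {FU : UltraFilter F} B
    (phi : T -> tree -> R) : 0 <= B -> (forall n, in_dual B (phi n)) ->
  in_dual B (fun t => ulim F (phi^~ t)).
Proof.
move=> B0 phiB; have FP : ProperFilter F := ultra_proper.
have [b /choice[S H]] := choice phiB.
pose Sl s t := `[< \forall n \near F, S n s t >].
have Slw s t : Sl s t -> exists n, S n s t.
  by move=> /asboolP/(@filter_ex _ F).
have nSl s t : ~~ Sl s t -> \forall n \near F, ~~ S n s t.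
  move=> /asboolPn nS.
  have [//|] := in_ultra_setVsetC [set n | S n s t] FU.
  by apply: filterS => n /= /negP.
exists (fun s => ulim F (b^~ s)), Sl; split.
- split.
  + by move=> s t /Slw[n]; have [[pS _ _ _] _ _ _] := H n; exact: pS.
  + move=> s t i /asboolP St si; apply/asboolP; apply: filterS St => n.
    by have [[_ cS _ _] _ _ _] := H n => St; exact: cS.
  + move=> s t t' /asboolP St /asboolP St' tt'.
    have [n [Sn Sn']] := @filter_ex _ F _ _ (filterI St St').
    by have [[_ _ hS _] _ _ _] := H n; exact: hS Sn Sn' tt'.
  + move=> s s' t /asboolP St /asboolP St'.
    have [n [Sn Sn']] := @filter_ex _ F _ _ (filterI St St').
    by have [[_ _ _ uS] _ _ _] := H n; exact: uS Sn Sn'.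
- by apply: sqb_ulim => // n; have [] := H n.
- move=> s t /asboolP St; apply: ulim_near; apply: filterS St => n.
  by have [_ _ phib _] := H n; exact: phib.
- move=> t nS; apply: ulim_near_cst.
  (* A segment through [t] starts at one of the finitely many prefixes of [t], so all of them can be
     excluded for the same [n]. *)
  have : \forall n \near F, forall i : 'I_(size t).+1, ~~ S n (take i t) t.
    by apply: filter_forall => i; exact: nSl.
  apply: filterS => n h; have [[pS _ _ _] _ _ phi0] := H n; apply: phi0 => s.
  apply/negP => Sst; have /prefixP[u tE] := pS _ _ Sst.
  have st : (size s < (size t).+1)%N by rewrite ltnS size_prefix// pS.
  have := h (Ordinal st); rewrite /= [in take _ t]tE take_size_cat//.
  by rewrite Sst.
Qed.

End SegmentSystems.

(** * The pairing and its boundary values *)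

Notation branch := (nat -> bool).

Definition path_sum (R : realType) (x : tree -> R) (g : branch) (h : nat) : R :=
  \sum_(0 <= i < h.+1) x (mkseq g i).

Section Branches.
Variable R : realType.
Implicit Types (x : tree -> R) (g : branch) (A : {fset branch}).

Definition split_by A h := {in A &, injective (fun g => mkseq g h)}.

Lemma split_byW A h h' : (h <= h')%N -> split_by A h -> split_by A h'.
Proof.
move=> hh' sA g g' gA g'A /(congr1 (take h)).
rewrite -!map_take !take_iota (minn_idPl hh').
exact: sA.
Qed.

Lemma split_by_ex A : exists h, split_by A h.
Proof.
have /choice[f hf] : forall p : A * A, exists n, forall h, (n <= h)%N ->
    mkseq (val p.1) h = mkseq (val p.2) h -> p.1 = p.2.
  move=> [g g']; have [->|/eqP gg'] := eqVneq g g'; first by exists 0%N.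
  have /existsNP[i /eqP gi] : ~ forall i, val g i = val g' i.
    by move=> /funext/val_inj.
  exists i.+1 => h ih /= /(congr1 (fun s => nth false s i)).
  by rewrite !nth_mkseq// => /eqP; rewrite (negbTE gi).
exists (\max_p f p) => g g' gA g'A.
have /hf/[apply] := leq_bigmax (F := f) ([` gA], [` g'A])%fset.
by move=> /(congr1 val).
Qed.

Lemma jtb_fin (C : R) x (I : finType) (S : I -> set tree) : jtb C x ->
  (forall i, segment (S i)) -> trivIset setT S ->
  \sum_i (\sum_(t \in S i) x t) ^+ 2 <= C ^+ 2.
Proof.
move=> xC sS dS.
rewrite (reindex (@enum_val _ I))/=; last exact/onW_bij/enum_val_bij.
apply: (xC _ (fun j => S (enum_val j))) => // i j _ _ ij.
by apply: enum_val_inj; apply: dS.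
Qed.

(** The lower 2-estimate. Above the level where the branches of [A] separate, pieces of different
    branches are disjoint; pieces of one branch are disjoint because the windows are. *)
Lemma jtb_windows (C : R) x A k (a b : 'I_k -> nat) : jtb C x ->
  (forall j, split_by A (a j)) ->
  (forall j j' i, (a j <= i < b j)%N -> (a j' <= i < b j')%N -> j = j') ->
  \sum_j \sum_(g <- A) (\sum_(a j <= i < b j) x (mkseq g i)) ^+ 2 <= C ^+ 2.
Proof.
move=> xC sA dab.
pose S (p : 'I_k * A) : set tree :=
  [set mkseq (val p.2) i | i in [set i | (a p.1 <= i < b p.1)%N]].
(* For [b p.1 = 0] the window is empty, but the closed interval up to [(b p.1).-1] could contain
   0. *)
have SE p : S p = if (b p.1 == 0)%N then
    [set mkseq (val p.2) i | i in [set i | (1 <= i <= 0)%N]] else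
    [set mkseq (val p.2) i | i in [set i | (a p.1 <= i <= (b p.1).-1)%N]].
  rewrite /S; case: (b p.1) => [|n] //=.
  rewrite (_ : (fun i => _) = (fun i => is_true (1 <= i <= 0)%N))//.
  by apply/funext => i; apply/propext; split; lia.
have sS p : segment (S p).
  by rewrite SE; case: ifP => _; [exists (val p.2), 1%N, 0%N|
    exists (val p.2), (a p.1), (b p.1).-1].
have dS : trivIset setT S.
  move=> [j g] [j' g'] _ _ [t [[i /= ij <-] [i' /= i'j' ii']]].
  have E : i' = i by have := congr1 size ii'; rewrite !size_mkseq.
  subst i'; have jj' := dab _ _ _ ij i'j'; subst j'; congr (_, _).
  have/andP[ai _] := ij.
  by apply/val_inj; apply: (split_byW ai (sA j)) (fsvalP g) (fsvalP g') _.
have := jtb_fin xC sS dS; rewrite -(pair_bigA _ (fun (j : 'I_k) (g : A) =>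
  (\sum_(t \in S (j, g)) x t) ^+ 2))/=.
apply: le_trans; apply: ler_sum => j _; rewrite big_seq_fsetE/=.
apply: ler_sum => g _; rewrite SE/=; case: eqP => [->|/eqP b0].
  by rewrite segment_sum !big_geq.
by rewrite segment_sum prednK// lt0n.
Qed.

Lemma path_sumB x g h h' : (h <= h')%N ->
  path_sum x g h' - path_sum x g h = \sum_(h.+1 <= i < h'.+1) x (mkseq g i).
Proof.
move=> hh'; rewrite /path_sum (big_cat_nat (n := h.+1) (p := h'.+1))//=.
by rewrite addrAC subrr add0r.
Qed.

Lemma jtb_path_sum C x g h : 0 <= C -> jtb C x -> `|path_sum x g h| <= C.
Proof. exact: jtb_path. Qed.

End Branches.

Section Truncations.
Variable R : realType.
Implicit Types (x phi : tree -> R).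

Definition below h x : tree -> R := fun t => if (size t < h)%N then x t else 0.

Lemma below_above h x t : x t = below h x t + above h x t.
Proof. by rewrite /below /above ltnNge; case: leqP; rewrite ?add0r ?addr0. Qed.

Lemma sum_bseq_widen (F : tree -> R) h n : (h <= n)%N ->
  (forall t, (h < size t)%N -> F t = 0) ->
  \sum_(t : n.-bseq bool) F t = \sum_(t : h.-bseq bool) F t.
Proof.
move=> hn F0; pose A := [set t : tree | (size t <= h)%N].
have E m : (h <= m)%N -> \sum_(t : m.-bseq bool) F t = \sum_(t \in A) F t.
  move=> hm; rewrite (@fsbig_bseq _ _ m) => [|t /= th]; last exact: leq_trans hm.
  apply: eq_bigr => t _; case: (leqP (size t) h) => th.
    by rewrite mem_set ?mul1r.
  by rewrite F0 ?mulr0.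
by rewrite !E.
Qed.

Lemma trunc_pairDl phi psi x h :
  trunc_pair (fun t => phi t + psi t) x h =
  trunc_pair phi x h + trunc_pair psi x h.
Proof. by rewrite -big_split; apply: eq_bigr => t _; rewrite mulrDl. Qed.

Lemma trunc_pairZl c phi x h :
  trunc_pair (fun t => c * phi t) x h = c * trunc_pair phi x h.
Proof. by rewrite mulr_sumr; apply: eq_bigr => t _; rewrite mulrA. Qed.

Lemma trunc_pairBr phi x y h :
  trunc_pair phi (fun t => x t - y t) h =
  trunc_pair phi x h - trunc_pair phi y h.
Proof. by rewrite -sumrB; apply: eq_bigr => t _; rewrite mulrBr. Qed.

End Truncations.

Section Pairing.
Variables (R : realType) (U : set_system nat).
Context {UU : UltraFilter U}.
Hypothesis Uinf : forall n, U [set m | (n < m)%N].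
Implicit Types (x phi : tree -> R) (g : branch).

Let UP : ProperFilter U := ultra_proper.
Local Existing Instance UP.

Definition tpair phi x : R := ulim U (trunc_pair phi x).

Definition bdry phi g : R := ulim U (fun h => phi (mkseq g h)).
Definition branch_sum x g : R := ulim U (path_sum x g).

Lemma trunc_pair_bnd B C phi x : 0 <= B -> 0 <= C -> in_dual B phi -> jtb C x ->
  bnd (trunc_pair phi x).
Proof. by move=> B0 C0 phiB xC; exists (B * C) => h; exact: trunc_pair_bound. Qed.

Lemma tpair_bound B C phi x : 0 <= B -> 0 <= C -> in_dual B phi -> jtb C x ->
  `|tpair phi x| <= B * C.
Proof. by move=> B0 C0 phiB xC; apply: ulim_norm => h; exact: trunc_pair_bound. Qed.

Lemma tpairBr B C D phi x y : 0 <= B -> 0 <= C -> 0 <= D -> in_dual B phi ->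
  jtb C x -> jtb D y ->
  tpair phi (fun t => x t - y t) = tpair phi x - tpair phi y.
Proof.
move=> B0 C0 D0 phiB xC yD; rewrite /tpair -ulimB; last 2 first.
- exact: trunc_pair_bnd phiB xC.
- exact: trunc_pair_bnd phiB yD.
by congr ulim; apply/funext => h; rewrite trunc_pairBr.
Qed.

(** The height depends on [x] alone, so the error is uniform in [phi]; [tpair_ulim] rests on
    this. *)
Lemma tpair_tail B C e phi x h : 0 <= B -> 0 <= C -> 0 <= e -> in_dual B phi ->
  jtb C x -> jtb e (above h x) ->
  `|tpair phi x - trunc_pair phi (below h x) h| <= B * e.
Proof.
move=> B0 C0 e0 phiB xC xe; apply: ulim_dist.
  exact: trunc_pair_bnd phiB xC.
apply: filterS (Uinf h) => n /= hn.
have <- : trunc_pair phi (below h x) n = trunc_pair phi (below h x) h.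
  apply: (@sum_bseq_widen _ (fun t => phi t * below h x t)); first exact: ltnW.
  by move=> t ht; rewrite /below ltnNge (ltnW ht)/= mulr0.
have -> : trunc_pair phi x n - trunc_pair phi (below h x) n =
    trunc_pair phi (above h x) n.
  rewrite -trunc_pairBr; apply: eq_bigr => t _.
  by rewrite [in x t](below_above h) addrAC subrr add0r.
exact: trunc_pair_bound.
Qed.

Lemma tpair_ulim B C (phi : nat -> tree -> R) x : 0 <= B -> 0 <= C ->
  (forall n, in_dual B (phi n)) -> jtb C x ->
  ulim U (fun n => tpair (phi n) x) = tpair (fun t => ulim U (phi^~ t)) x.
Proof.
move=> B0 C0 phiB xC; apply/eqP; rewrite -subr_eq0 -normr_le0.
apply/ler_addgt0Pl => e e0; rewrite addr0.
pose d := e / (2 * (B + 1)).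
have B1 : 0 < B + 1 by rewrite ltr_wpDl.
have d0 : 0 < d by rewrite divr_gt0// mulr_gt0.
have [h hd] := jtb_tail xC d0.
have bphi t : bnd (phi^~ t) by exists B => n; exact: in_dual_eval.
have bp : bnd (fun n => tpair (phi n) x).
  by exists (B * C) => n; exact: tpair_bound.
have bs t : bnd (fun n => phi n t * below h x t).
  by apply: bndM => //; exact: bnd_cst.
have h1 : `|ulim U (fun n => tpair (phi n) x)
    - ulim U (fun n => trunc_pair (phi n) (below h x) h)| <= B * d.
  rewrite -ulimB//; last by apply: bnd_sum => t _.
  by apply: ulim_norm => n; apply: tpair_tail xC hd => //; exact: ltW.
have h2 : `|tpair (fun t => ulim U (phi^~ t)) x
    - ulim U (fun n => trunc_pair (phi n) (below h x) h)| <= B * d.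
  rewrite ulim_sum//.
  rewrite (eq_bigr (fun t : h.-bseq bool => ulim U (phi^~ t) * below h x t)).
    apply: tpair_tail xC hd => //; first exact: ltW.
    exact: in_dual_ulim.
  by move=> t _; rewrite ulimM ?ulim_cst//; exact: bnd_cst.
have {h1 h2} := lerD h1 h2.
rewrite [X in _ + X]distrC => hh; apply: le_trans (ler_distD _ _ _) _.
apply: le_trans hh _; rewrite /d -mulrDl.
have -> : (B + B) * (e / (2 * (B + 1))) = e * (B / (B + 1)).
  by field; rewrite gt_eqF.
by rewrite ger_pMr// ler_pdivrMr// mul1r lerDl.
Qed.

Lemma bdry_bnd B phi g : 0 <= B -> in_dual B phi -> bnd (fun h => phi (mkseq g h)).
Proof. by move=> B0 phiB; exists B => h; exact: in_dual_eval. Qed.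

(** At a high level the branches of [A] pass through distinct nodes, where [in_dual_level]
    applies. *)
Lemma bdry_sqb B phi : 0 <= B -> in_dual B phi -> sqb B (bdry phi).
Proof.
move=> B0 phiB A.
have bp g := bdry_bnd g B0 phiB.
rewrite (eq_bigr (fun g => ulim U (fun h => phi (mkseq g h) ^+ 2))); last first.
  by move=> g _; rewrite expr2 -ulimM.
rewrite -ulim_sum => [|g _]; last exact: bndM.
apply: ulim_le; first by apply: bnd_sum => g _; exact: bndM.
have [h0 sA] := split_by_ex A.
apply: filterS (Uinf h0) => h /= /ltnW h0h.
have := @in_dual_level _ B phi [seq mkseq g h | g <- A] h B0 phiB.
rewrite big_map; apply.
  rewrite map_inj_in_uniq ?fset_uniq// => g g' gA g'A.
  exact: (split_byW h0h sA).
by move=> _ /mapP[g _ ->]; rewrite size_mkseq.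
Qed.

Lemma path_sum_bnd C x g : 0 <= C -> jtb C x -> bnd (path_sum x g).
Proof. by move=> C0 xC; exists C => h; exact: jtb_path_sum. Qed.

Lemma branch_sum_bound C x g : 0 <= C -> jtb C x -> `|branch_sum x g| <= C.
Proof. by move=> C0 xC; apply: ulim_norm => h; exact: jtb_path_sum. Qed.

Lemma path_sum_ulim C (x : nat -> tree -> R) g h : 0 <= C ->
  (forall m, jtb C (x m)) ->
  ulim U (fun m => path_sum (x m) g h) = path_sum (fun t => ulim U (x^~ t)) g h.
Proof.
move=> C0 xC; rewrite /path_sum ulim_sum// => i _.
by exists C => m; exact: jtb_eval.
Qed.

Definition jump (x : nat -> tree -> R) g : R :=
  ulim U (fun m => branch_sum (x m) g) - branch_sum (fun t => ulim U (x^~ t)) g.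

(** On a finite set of branches the jump is a limit in [h0], then [m], then [h], of the sums of
    [x m] between the levels [h0] and [h]. Once [h0] separates the branches, these are sums over
    disjoint segments. *)
Lemma jump_sqb C (x : nat -> tree -> R) : 0 <= C -> (forall m, jtb C (x m)) ->
  sqb C (jump x).
Proof.
move=> C0 xC A.
have bp m g := path_sum_bnd g C0 (xC m).
have bpm g h : bnd (fun m => path_sum (x m) g h).
  by exists C => m; exact: jtb_path_sum.
have bb g : bnd (fun m => branch_sum (x m) g).
  by exists C => m; exact: branch_sum_bound.
have bX g : bnd (path_sum (fun t => ulim U (x^~ t)) g).
  exact: path_sum_bnd C0 (jtb_ulim C0 xC).
have b1 g h0 m : bnd (fun h => path_sum (x m) g h - path_sum (x m) g h0).
  by apply: bndB => //; exact: bnd_cst.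
have b2 g h0 : bnd (fun m => branch_sum (x m) g - path_sum (x m) g h0).
  exact: bndB.
have b3 g : bnd (fun h0 => ulim U (fun m => branch_sum (x m) g) -
    path_sum (fun t => ulim U (x^~ t)) g h0).
  by apply: bndB => //; exact: bnd_cst.
rewrite (eq_bigr (fun g => ulim U (fun h0 => (ulim U (fun m =>
    branch_sum (x m) g) - path_sum (fun t => ulim U (x^~ t)) g h0) ^+ 2)));
    last first.
  move=> g _; rewrite expr2 ulimM// ulimB//; last exact: bnd_cst.
  by rewrite ulim_cst -expr2.
rewrite -ulim_sum => [|g _]; last exact: bndM.
apply: ulim_le; first by apply: bnd_sum => g _; exact: bndM.
have [hA sA] := split_by_ex A.
apply: filterS (Uinf hA) => h0 /= /ltnW hAh0.
rewrite (eq_bigr (fun g => ulim U (fun m =>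
    (branch_sum (x m) g - path_sum (x m) g h0) ^+ 2))); last first.
  by move=> g _; rewrite -(path_sum_ulim _ _ C0 xC) [RHS]ulimM// ulimB.
rewrite -ulim_sum => [|g _]; last exact: bndM.
apply: ulim_le; first by apply: bnd_sum => g _; exact: bndM.
apply: nearW => m.
rewrite (eq_bigr (fun g => ulim U (fun h =>
    (path_sum (x m) g h - path_sum (x m) g h0) ^+ 2))); last first.
  move=> g _; rewrite [RHS]ulimM// ulimB//; last exact: bnd_cst.
  by rewrite ulim_cst.
rewrite -ulim_sum => [|g _]; last exact: bndM.
apply: ulim_le; first by apply: bnd_sum => g _; exact: bndM.
apply: filterS (Uinf h0) => h /= /ltnW h0h.
rewrite (eq_bigr (fun g => (\sum_(h0.+1 <= i < h.+1)
  x m (mkseq g i)) ^+ 2)) => [|g _]; last by rewrite path_sumB.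
have := @jtb_windows _ C (x m) A 1 (fun=> h0.+1) (fun=> h.+1) (xC m).
rewrite big_ord1; apply=> [_|]; first exact: split_byW (leqW hAh0) sA.
by move=> j j' _ _ _; rewrite !ord1.
Qed.

End Pairing.

(** * Exchanging the pairing with a pointwise limit of vectors *)

Section JumpFormula.
Variables (R : realType) (U : set_system nat) (V : set_system {fset branch}).
Context {UU : UltraFilter U} {VU : UltraFilter V}.
Hypothesis Uinf : forall n, U [set m | (n < m)%N].
Hypothesis Vsub : forall A : {fset branch}, V [set B | A `<=` B]%fset.

Let UP : ProperFilter U := ultra_proper.
Local Existing Instance UP.

Implicit Types (phi psi : tree -> R) (g : branch).

(** What the linearity of [defect] requires. Unlike [in_dual] it is visibly stable under sums, where
    segments of two systems may overlap. *)
Definition admissible phi := exists B, [/\ 0 <= B, bounded_by B phi,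
  forall C y h, 0 <= C -> jtb C y -> `|trunc_pair phi y h| <= B * C &
  sqb B (bdry U phi)].

Lemma in_dual_admissible B phi : 0 <= B -> in_dual B phi -> admissible phi.
Proof.
move=> B0 phiB; exists B; split=> //.
- by move=> t; exact: in_dual_eval.
- by move=> C y h C0 yC; exact: trunc_pair_bound.
- exact: bdry_sqb.
Qed.

Lemma bdryD phi psi : admissible phi -> admissible psi ->
  bdry U (fun t => phi t + psi t) = (fun g => bdry U phi g + bdry U psi g).
Proof.
move=> [B [B0 phiB _ _]] [D [D0 psiD _ _]]; apply/funext => g.
by rewrite /bdry ulimD//; [exists B|exists D] => h.
Qed.

Lemma bdryZ c phi : admissible phi ->
  bdry U (fun t => c * phi t) = (fun g => c * bdry U phi g).
Proof.
move=> [B [B0 phiB _ _]]; apply/funext => g.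
by rewrite /bdry ulimZ//; exists B => h.
Qed.

Lemma admissibleD phi psi : admissible phi -> admissible psi ->
  admissible (fun t => phi t + psi t).
Proof.
move=> aphi apsi; have E := bdryD aphi apsi.
move: aphi apsi => [B [B0 phiB phiP phib]] [D [D0 psiD psiP psib]].
exists (B + D); split.
- exact: addr_ge0.
- by move=> t; rewrite (le_trans (ler_normD _ _))// lerD.
- move=> C y h C0 yC; rewrite trunc_pairDl (le_trans (ler_normD _ _))// mulrDl.
  by rewrite lerD// ?phiP ?psiP.
- by rewrite E; exact: sqbD.
Qed.

Lemma admissibleZ c phi : admissible phi -> admissible (fun t => c * phi t).
Proof.
move=> aphi; have E := bdryZ c aphi.
move: aphi => [B [B0 phiB phiP phib]].
exists (`|c| * B); split.
- exact: mulr_ge0.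
- by move=> t; rewrite normrM ler_wpM2l.
- by move=> C y h C0 yC; rewrite trunc_pairZl normrM -mulrA ler_wpM2l// phiP.
- by rewrite E; exact: sqbZ.
Qed.

Variables (x : nat -> tree -> R) (C : R).
Hypotheses (C0 : 0 <= C) (xC : forall m, jtb C (x m)).

Let X t := ulim U (x^~ t).
Let XC : jtb C X. Proof. exact: jtb_ulim. Qed.
Let JC : sqb C (jump U x). Proof. exact: jump_sqb. Qed.

(* The failure of [tpair_jump]; it vanishes on single segments, and the functionals
   in [in_dual] are norm limits of combinations of those. *)
Definition defect phi : R := ulim U (fun m => tpair U phi (x m)) -
  tpair U phi X - l2_pair V (bdry U phi) (jump U x).

Let tpair_bnd phi : admissible phi -> bnd (fun m => tpair U phi (x m)).
Proof.
by move=> [B [B0 _ phiP _]]; exists (B * C) => m; apply: ulim_norm => h; exact: phiP.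
Qed.

Let trunc_bnd phi y : admissible phi -> jtb C y -> bnd (trunc_pair phi y).
Proof. by move=> [B [B0 _ phiP _]] yC; exists (B * C) => h; exact: phiP. Qed.

Lemma defectD phi psi : admissible phi -> admissible psi ->
  defect (fun t => phi t + psi t) = defect phi + defect psi.
Proof.
move=> aphi apsi; rewrite /defect bdryD//.
have tD y : jtb C y ->
    tpair U (fun t => phi t + psi t) y = tpair U phi y + tpair U psi y.
  move=> yC; rewrite /tpair -ulimD//; [|exact: trunc_bnd|exact: trunc_bnd].
  by congr ulim; apply/funext => h; rewrite trunc_pairDl.
rewrite tD//; under [in X in X - _ - _]eq_fun do rewrite tD//.
rewrite ulimD; [|exact: tpair_bnd|exact: tpair_bnd].
have [B [B0 _ _ bB]] := aphi; have [D [D0 _ _ bD]] := apsi.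
rewrite (@pairDl _ _ _ _ (B + D) C)//; [by ring|exact: addr_ge0| |].
- by apply: sqbW bB => //; rewrite lerDl.
- by apply: sqbW bD => //; rewrite lerDr.
Qed.

Lemma defectZ c phi : admissible phi ->
  defect (fun t => c * phi t) = c * defect phi.
Proof.
move=> aphi; rewrite /defect bdryZ//.
have tZ y : jtb C y -> tpair U (fun t => c * phi t) y = c * tpair U phi y.
  move=> yC; rewrite /tpair -ulimZ//; last exact: trunc_bnd.
  by congr ulim; apply/funext => h; rewrite trunc_pairZl.
rewrite tZ//; under [in X in X - _ - _]eq_fun do rewrite tZ//.
rewrite ulimZ; last exact: tpair_bnd.
have [B [B0 _ _ bB]] := aphi.
by rewrite (@pairZl _ _ _ _ B C)//; ring.
Qed.

Lemma defect_bound B phi : 0 <= B -> in_dual B phi ->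
  `|defect phi| <= B * C *+ 3.
Proof.
move=> B0 phiB.
have h1 : `|ulim U (fun m => tpair U phi (x m))| <= B * C.
  by apply: ulim_norm => m; exact: tpair_bound.
have h2 : `|tpair U phi X| <= B * C by exact: tpair_bound.
have h3 : `|l2_pair V (bdry U phi) (jump U x)| <= B * C.
  by apply: pair_norm => //; exact: bdry_sqb.
rewrite /defect (le_trans (ler_normB _ _))// mulrS mulr2n addrC lerD//.
by rewrite (le_trans (ler_normB _ _))// lerD.
Qed.

Section SingleSegment.
Variables (S : tree -> tree -> bool) (s : tree).
Hypothesis sS : seg_system S.

Definition seg_char t : R := (S s t)%:R.

Lemma seg_char_in_dual : in_dual 1 seg_char.
Proof.
exists (fun s' => (s' == s)%:R), (fun s' t => (s' == s) && S s t); split.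
- case: sS => pS cS hS uS; split.
  + by move=> s' t /andP[/eqP->]; exact: pS.
  + by move=> s' t i /andP[/eqP->] St si; rewrite eqxx cS.
  + by move=> s' t t' /andP[_ St] /andP[_ St']; exact: hS St St'.
  + by move=> s1 s2 t /andP[/eqP-> _] /andP[/eqP-> _].
- move=> A; rewrite expr1n; have [sA|sA] := boolP (s \in A); last first.
    rewrite big_seq big1// => i iA; rewrite (_ : _ == _ = false) ?expr0n//.
    by apply: contraNF sA => /eqP <-.
  rewrite (bigD1_seq s) ?fset_uniq//= eqxx expr1n big1 ?addr0// => i /negbTE ->.
  by rewrite expr0n.
- by move=> s' t /andP[/eqP-> St]; rewrite /seg_char St eqxx.
- by move=> t /(_ s); rewrite eqxx/= /seg_char => /negbTE ->.
Qed.

(** A segment that misses level [n] ends below it. Pairing with it is a finite sum, which commutes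
    with the limit, and its boundary values vanish. *)
Lemma defect_finite_segment n : (size s <= n)%N ->
  (forall t, S s t -> size t <> n) -> defect seg_char = 0.
Proof.
move=> sn nS; case: sS => pS cS hS uS.
have Sn t : S s t -> (size t < n)%N.
  move=> St; rewrite ltnNge; apply/negP => nt.
  by apply: (nS _ (cS _ _ _ St sn)); rewrite size_takel.
have tE y : tpair U seg_char y = trunc_pair seg_char y n.
  apply: ulim_near_cst; apply: filterS (Uinf n) => h /= /ltnW nh.
  apply: (@sum_bseq_widen _ (fun t => seg_char t * y t)) => // t nt.
  rewrite /seg_char (_ : S s t = false) ?mul0r//.
  by apply/negP => /Sn; rewrite ltnNge (ltnW nt).
rewrite /defect tE; under [in X in X - _ - _]eq_fun do rewrite tE.
rewrite ulim_sum => [|t _]; last first.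
  by apply: bndM; [exact: bnd_cst|exists C => m; exact: jtb_eval].
rewrite (eq_bigr (fun t : n.-bseq bool => seg_char t * X t)); last first.
  by move=> t _; rewrite ulimZ//; exists C => m; exact: jtb_eval.
rewrite subrr sub0r (_ : bdry U seg_char = fun=> 0).
  rewrite /l2_pair (_ : (fun A : {fset branch} => _) = fun=> 0) ?ulim_cst ?oppr0//.
  by apply/funext => A; rewrite big1// => i _; rewrite mul0r.
apply/funext => g; apply: ulim_near_cst; apply: filterS (Uinf n) => h /= nh.
rewrite /seg_char (_ : S s _ = false)//; apply/negP => /Sn.
by rewrite size_mkseq ltnNge (ltnW nh).
Qed.

(** The pairing is the full sum along [g] minus a finite initial sum. The initial sum commutes with
    the limit, the full sum is off by the jump at [g], and the boundary value is the unit vector at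
    [g]. *)
Lemma defect_infinite_segment g :
  (forall t, S s t <-> exists2 i, (size s <= i)%N & t = mkseq g i) ->
  defect seg_char = 0.
Proof.
move=> Sg; pose start y : R := \sum_(0 <= i < size s) y (mkseq g i).
have tE y : jtb C y -> tpair U seg_char y = branch_sum U y g - start y.
  move=> yC; rewrite /branch_sum -[start y](@ulim_cst _ _ U) -ulimB; last 2 first.
  - exact: path_sum_bnd yC.
  - exact: bnd_cst.
  apply: ulim_near; apply: filterS (Uinf (size s)) => h /= sh.
  have -> : trunc_pair seg_char y h = \sum_(t \in [set mkseq g i | i in
      [set i | (size s <= i <= h)%N]]) y t.
    rewrite (@fsbig_bseq _ _ h) => [|_ [i /= /andP[_ ih] <-]]; last first.
      by rewrite size_mkseq.
    apply: eq_bigr => t _; congr (_%:R * _); congr nat_of_bool.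
    apply/idP/idP.
      move=> /Sg[i si tE]; rewrite tE mem_set//; exists i => //=.
      by rewrite si -(size_mkseq g i) -tE size_bseq.
    by rewrite inE => -[i /= /andP[si ih] it]; apply/Sg; exists i.
  rewrite segment_sum /path_sum [in RHS](big_cat_nat (n := size s))//=.
    by rewrite addrAC subrr add0r.
  exact: leqW (ltnW sh).
have bE : bdry U seg_char = (fun g' => (g' == g)%:R).
  apply/funext => g'; apply: ulim_near_cst; have [->|g'g] := eqVneq g' g.
    apply: filterS (Uinf (size s)) => h /= /ltnW sh; rewrite /seg_char.
    by rewrite (_ : S s _ = true)//; apply/Sg; exists h.
  have [h0 sA] := split_by_ex [fset g; g']%fset.
  apply: filterS (Uinf h0) => h /= /ltnW h0h; rewrite /seg_char.
  rewrite (_ : S s _ = false)//; apply/negP => /Sg[i si].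
  move=> hi; have E : h = i by have := congr1 size hi; rewrite !size_mkseq.
  subst i; move/eqP: g'g; apply; apply: (split_byW h0h sA) => //;
    by rewrite !inE eqxx ?orbT.
rewrite /defect tE// bE (pair_delta Vsub _ C0 JC).
under [in X in X - _ - _]eq_fun do rewrite tE//.
rewrite ulimB; last 2 first.
- by exists C => m; exact: branch_sum_bound.
- by apply: bnd_sum => i _; exists C => m; exact: jtb_eval.
have -> : ulim U (fun m => start (x m)) = start X.
  by apply: ulim_sum => i _; exists C => m; exact: jtb_eval.
by rewrite /jump -/X; ring.
Qed.

Lemma defect_segment : defect seg_char = 0.
Proof.
case: (sS) => pS cS hS uS.
have [H|] := pselect (forall n, (size s <= n)%N -> exists t, S s t /\ size t = n);
    last first.
  move=> /existsNP[n /not_implyP[sn nS]].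
  by apply: (defect_finite_segment sn) => t St tn; apply: nS; exists t.
have /choice[u uE] : forall n, exists t, (size s <= n)%N -> S s t /\ size t = n.
  move=> n; have [/H[t Ht]|] := leqP (size s) n; first by exists t.
  by exists [::].
(* Bit [i] is read off a node of the segment long enough to contain it; the nodes are nested, so the
   choice of level is immaterial. *)
pose g i := nth false (u (maxn i.+1 (size s))) i.
have gE n : (size s <= n)%N -> mkseq g n = u n.
  move=> sn; have [Sun un] := uE _ sn.
  apply: (@eq_from_nth _ false); first by rewrite size_mkseq.
  rewrite size_mkseq => i iN; rewrite nth_mkseq// /g.
  set m := maxn _ _; have sm : (size s <= m)%N by rewrite leq_maxr.
  have [Sum um] := uE _ sm.
  have mn : (m <= n)%N by rewrite geq_max iN.
  by rewrite (hS _ _ _ Sum Sun) um ?un// nth_take// leq_maxl.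
apply: (@defect_infinite_segment g) => t; split=> [St|[i si ->]]; last first.
  by rewrite gE//; have [] := uE _ si.
have st : (size s <= size t)%N by rewrite size_prefix// pS.
exists (size t) => //; rewrite gE//; have [Su ut] := uE _ st.
by rewrite (hS _ _ _ St Su) ?ut// take_oversize// ut.
Qed.

End SingleSegment.

Lemma defect_eq0 phi : in_dual 1 phi -> defect phi = 0.
Proof.
move=> [b [S [sS b1 phib phi0]]].
apply/eqP; rewrite -normr_le0; apply/ler_addgt0Pl => e e0; rewrite addr0.
have C1 : 0 < C + 1 by rewrite ltr_wpDl.
(* The 3 is the constant of [defect_bound]. *)
pose d := e / (3 * (C + 1)).
have d0 : 0 < d by rewrite divr_gt0// mulr_gt0.
have [A hA] := sqb_tail b1 d0.
pose phiA (r : seq tree) t : R := \sum_(s <- r) b s * seg_char S s t.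
have phiA0 r : admissible (phiA r) /\ defect (phiA r) = 0.
  elim: r => [|s r [ar dr]].
    have E : phiA [::] = (fun t => 0 * seg_char S [::] t).
      by apply/funext => t; rewrite /phiA big_nil mul0r.
    have a0 := in_dual_admissible ler01 (seg_char_in_dual [::] sS).
    by rewrite E; split; [exact: admissibleZ|rewrite defectZ// mul0r].
  have E : phiA (s :: r) = (fun t => b s * seg_char S s t + phiA r t).
    by apply/funext => t; rewrite /phiA big_cons.
  have as_ := in_dual_admissible ler01 (seg_char_in_dual s sS).
  have abs := admissibleZ (b s) as_.
  rewrite E; split; first exact: admissibleD.
  by rewrite defectD// defectZ// dr addr0 defect_segment// mulr0.
have phiAS s t : S s t -> phiA A t = if s \in A then b s else 0.
  move=> Sst; case: sS => _ _ _ uS.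
  have z s' : s' != s -> b s' * seg_char S s' t = 0.
    move=> s's; rewrite /seg_char (_ : S s' t = false) ?mulr0//.
    by apply: contra_neqF s's => Ss't; exact: uS Ss't Sst.
  case: ifPn => sA.
    by rewrite /phiA (bigD1_seq s) ?fset_uniq//= /seg_char Sst mulr1 big1 ?addr0.
  rewrite /phiA big_seq big1// => s' s'A; apply: z.
  by apply: contraNneq sA => <-.
(* The remainder lives on the same system, with the coefficients in [A] set to 0. *)
have psid : in_dual d (fun t => phi t - phiA A t).
  exists (fun s => if s \in A then 0 else b s), S; split=> //.
  - move=> A'; apply: le_trans (hA (A `|` A')%fset _); last first.
      exact: fsubsetUl.
    rewrite [leLHS](bigID (mem A))/= big1 ?add0r => [|s ->]; last first.
      by rewrite expr0n.
    rewrite -big_filter -[leRHS]big_filter.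
    rewrite [leRHS](perm_big [seq s <- A' | s \notin A]); last first.
      apply: uniq_perm; rewrite ?filter_uniq// => s.
      by rewrite !mem_filter !inE/=; case: (s \in A).
    rewrite le_eqVlt; apply/orP; left; apply/eqP.
    rewrite !big_filter; apply: eq_bigr => s /negbTE ->.
    by [].
  - move=> s t Sst; rewrite (phib _ _ Sst) (phiAS _ _ Sst).
    by case: ifP => _; rewrite ?subrr ?subr0.
  - move=> t nS; rewrite phi0// /phiA big1 ?subr0// => s _.
    by rewrite /seg_char (negbTE (nS s)) mulr0.
have [aA dA] := phiA0 A.
have E : phi = (fun t => (phi t - phiA A t) + phiA A t).
  by apply/funext => t; rewrite subrK.
rewrite E defectD//; last exact: in_dual_admissible (ltW d0) psid.
rewrite dA addr0 (le_trans (defect_bound (ltW d0) psid))//.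
have -> : d * C *+ 3 = e * (C / (C + 1)).
  by rewrite /d -mulr_natl; field; rewrite gt_eqF.
by rewrite ger_pMr// ler_pdivrMr// mul1r lerDl.
Qed.

Lemma tpair_jump phi : in_dual 1 phi ->
  ulim U (fun m => tpair U phi (x m)) =
  tpair U phi X + l2_pair V (bdry U phi) (jump U x).
Proof.
move=> /defect_eq0 /eqP; rewrite /defect -addrA -opprD subr_eq0 => /eqP.
by [].
Qed.

End JumpFormula.

(** The equality case of Cauchy-Schwarz: the coefficient on [S j] is the sum of [x] over [S j],
    divided by the norm [E] of the vector of these sums. *)
Lemma in_dual_norming (R : realType) (U : set_system nat) {UU : UltraFilter U}
    (Uinf : forall n, U [set m | (n < m)%N])
    (x : tree -> R) k (S : 'I_k -> set tree) :
  (forall j, segment (S j)) -> trivIset setT S -> 0 < jt_sum x S ->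
  exists2 phi, in_dual 1 phi & tpair U phi x = jt_sum x S.
Proof.
move=> sS dS; set E := jt_sum x S => E0.
have UP : ProperFilter U := ultra_proper.
pose a j := \sum_(t \in S j) x t.
have aE : \sum_j a j ^+ 2 = E ^+ 2 by rewrite jt_sum_sqr.
have /choice[c hc] : forall j, exists c : branch * nat * nat,
    S j = [set mkseq c.1.1 i | i in [set i | (c.1.2 <= i <= c.2)%N]].
  by move=> j; have [g [m [n ->]]] := sS j; exists (g, m, n).
pose st j := mkseq (c j).1.1 (c j).1.2.
have stS j t : S j t -> S j (st j).
  rewrite hc => -[i /= /andP[mi iN] _]; exists (c j).1.2 => //=.
  by rewrite leqnn (leq_trans mi iN).
have Suniq i j t : S i t -> S j t -> i = j.
  by move=> Si Sj; apply: dS => //; exists t.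
(* An empty [S j] also yields a node [st j], which may be the first node of another segment; the
   second conjunct excludes it. *)
pose q s j := (s == st j) && (st j \in S j).
pose b s := \sum_j (q s j)%:R * (a j / E).
have quniq s i j : q s i -> q s j -> i = j.
  move=> /andP[/eqP si /set_mem Si] /andP[/eqP sj /set_mem Sj].
  by apply: (Suniq i j s); [rewrite si|rewrite sj].
have bE s j : q s j -> b s = a j / E.
  move=> qj; rewrite /b (bigD1 j)//= qj mul1r big1 ?addr0// => i ij.
  rewrite (_ : q s i = false) ?mul0r//; apply: contra_neqF ij => qi.
  exact: quniq qi qj.
pose phi t := \sum_j (t \in S j)%:R * (a j / E).
have phiE t j : S j t -> phi t = a j / E.
  move=> Sj; rewrite /phi (bigD1 j)//= mem_set// mul1r big1 ?addr0// => i ij.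
  rewrite (_ : t \in S i = false) ?mul0r//; apply: contra_neqF ij => /set_mem Si.
  exact: Suniq Si Sj.
exists phi.
  exists b, (fun s t => `[< exists j, s = st j /\ S j t >]); split.
  - split.
    + move=> s t /asboolP[j [-> Sjt]]; apply/prefixP.
      move: Sjt; rewrite hc => -[i /= /andP[mi iN] <-].
      exists (drop (c j).1.2 (mkseq (c j).1.1 i)).
      by rewrite /st -[mkseq _ (c j).1.2](_ : take (c j).1.2
        (mkseq (c j).1.1 i) = _) ?cat_take_drop// -map_take take_iota (minn_idPl mi).
    + move=> s t i /asboolP[j [-> Sjt]] si; apply/asboolP; exists j; split=> //.
      move: Sjt; rewrite hc => -[l /= /andP[ml lN] <-].
      rewrite -map_take take_iota.
      exists (minn i l) => //=; rewrite size_mkseq in si.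
      by rewrite leq_min si ml/= (leq_trans (geq_minr _ _)).
    + move=> s t t' /asboolP[j [sj Sjt]] /asboolP[j' [sj' Sjt']].
      have jj' : j = j'.
        apply: (Suniq j j' s); first by rewrite sj; exact: stS Sjt.
        by rewrite sj'; exact: stS Sjt'.
      subst j'; move: Sjt Sjt'; rewrite hc => -[i _ <-] [i' _ <-].
      by rewrite !size_mkseq -map_take take_iota => /minn_idPl ->.
    + move=> s s' t /asboolP[j [-> Sjt]] /asboolP[j' [-> Sjt']].
      by rewrite (Suniq _ _ _ Sjt Sjt').
  - move=> A; rewrite expr1n.
    have b2 s : b s ^+ 2 = \sum_j (q s j)%:R * (a j / E) ^+ 2.
      have [[j qj]|nq] := pselect (exists j, q s j).
        rewrite (bE _ _ qj) (bigD1 j)//= qj mul1r big1 ?addr0// => i ij.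
        rewrite (_ : q s i = false) ?mul0r//; apply: contra_neqF ij => qi.
        exact: quniq qi qj.
      have q0 j : q s j = false by apply/negP => qj; apply: nq; exists j.
      by rewrite /b !big1 ?expr0n// => j _; rewrite q0 mul0r.
    under eq_bigr do rewrite b2.
    rewrite exchange_big/=.
    have E1 : \sum_j (a j / E) ^+ 2 = 1.
      under eq_bigr do rewrite expr_div_n.
      by rewrite -mulr_suml aE divff// expf_neq0// gt_eqF.
    rewrite -[leRHS]E1.
    apply: ler_sum => j _; rewrite -mulr_suml ler_piMl ?sqr_ge0//.
    have [sA|sA] := boolP (st j \in A); last first.
      rewrite big_seq big1// => s sA'; rewrite /q (_ : s == _ = false)//.
      by apply: contraNF sA => /eqP <-.
    rewrite (bigD1_seq (st j)) ?fset_uniq//= big1 ?addr0; last first.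
      by move=> s /negbTE ss; rewrite /q ss.
    by rewrite lern1 leq_b1.
  - move=> s t /asboolP[j [sj Sjt]]; rewrite (phiE _ _ Sjt).
    by rewrite (bE _ j)// /q sj eqxx mem_set//; exact: stS Sjt.
  - move=> t nS; rewrite /phi big1// => j _.
    rewrite (_ : t \in S j = false) ?mul0r//; apply/negP => /set_mem Sjt.
    by have /negP := nS (st j); apply; apply/asboolP; exists j.
have [h hh] := segment_height sS.
apply: ulim_near_cst; apply: filterS (Uinf h) => n /= hn.
transitivity (\sum_j a j / E * \sum_(t \in S j) x t).
  rewrite /trunc_pair; under eq_bigr do rewrite mulr_suml.
  rewrite exchange_big/=; apply: eq_bigr => j _.
  rewrite (@fsbig_bseq _ _ n) => [|t /hh /ltnW tn]; last first.
    exact: leq_trans tn (ltnW hn).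
  by rewrite mulr_sumr; apply: eq_bigr => t _; rewrite mulrAC mulrC.
rewrite (eq_bigr (fun j => E^-1 * a j ^+ 2)); last first.
  by move=> j _; rewrite -/(a j); ring.
by rewrite -mulr_sumr aE expr2 mulKf// gt_eqF.
Qed.

(** * Iterated limits *)

Section IteratedLimits.
Variables (R : realType) (U : set_system nat).
Context {UU : UltraFilter U}.
Hypothesis Uinf : forall n, U [set m | (n < m)%N].

Let UP : ProperFilter U := ultra_proper.
Local Existing Instance UP.

Fixpoint ilim (I : Type) k (f : seq nat -> I -> R) : I -> R :=
  if k is k'.+1 then fun i => ulim U (fun n => ilim k' (fun s => f (n :: s)) i)
  else f [::].

(* Iterated limit in the interlaced order [n_1, m_1, n_2, m_2, ...], with [n_1]
   outermost. *)
Fixpoint jlim k (psi : seq nat -> seq nat -> R) : R :=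
  if k is k'.+1 then ulim U (fun n => ulim U (fun m =>
    jlim k' (fun N M => psi (n :: N) (m :: M))))
  else psi [::] [::].

Definition bnd2 (psi : seq nat -> seq nat -> R) :=
  exists B, forall N M, `|psi N M| <= B.

Lemma jlim_norm B k psi : (forall N M, `|psi N M| <= B) -> `|jlim k psi| <= B.
Proof.
elim: k psi => [|k IH] psi psiB /=; first exact: psiB.
by apply: ulim_norm => n; apply: ulim_norm => m; exact: IH.
Qed.

Lemma bnd2_cons psi n m : bnd2 psi -> bnd2 (fun N M => psi (n :: N) (m :: M)).
Proof. by move=> [B h]; exists B. Qed.

Lemma bnd_jlim k psi n : bnd2 psi ->
  bnd (fun m => jlim k (fun N M => psi (n :: N) (m :: M))).
Proof. by move=> [B h]; exists B => m; exact: jlim_norm. Qed.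

Lemma bnd_ulim_jlim k psi : bnd2 psi ->
  bnd (fun n => ulim U (fun m => jlim k (fun N M => psi (n :: N) (m :: M)))).
Proof.
by move=> [B h]; exists B => n; apply: ulim_norm => m; exact: jlim_norm.
Qed.

Lemma bnd2D psi chi : bnd2 psi -> bnd2 chi -> bnd2 (fun N M => psi N M + chi N M).
Proof.
move=> [B h] [C h']; exists (B + C) => N M.
by rewrite (le_trans (ler_normD _ _))// lerD.
Qed.

Lemma bnd2B psi chi : bnd2 psi -> bnd2 chi -> bnd2 (fun N M => psi N M - chi N M).
Proof.
move=> [B h] [C h']; exists (B + C) => N M.
by rewrite (le_trans (ler_normB _ _))// lerD.
Qed.

Lemma bnd2M psi chi : bnd2 psi -> bnd2 chi -> bnd2 (fun N M => psi N M * chi N M).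
Proof.
move=> [B h] [C h']; exists (B * C) => N M.
by rewrite normrM ler_pM.
Qed.

Lemma bnd2_sum (I : Type) (r : seq I) (psi : I -> seq nat -> seq nat -> R) :
  (forall i, bnd2 (psi i)) -> bnd2 (fun N M => \sum_(i <- r) psi i N M).
Proof.
move=> h; elim: r => [|i r IH].
  by exists 0 => N M; rewrite big_nil normr0.
have [B hB] := bnd2D (h i) IH.
by exists B => N M; rewrite big_cons.
Qed.

Lemma jlimD k psi chi : bnd2 psi -> bnd2 chi ->
  jlim k (fun N M => psi N M + chi N M) = jlim k psi + jlim k chi.
Proof.
elim: k psi chi => [|k IH] psi chi bpsi bchi //=.
rewrite -ulimD; [|exact: bnd_ulim_jlim..]; congr ulim; apply/funext => n.
rewrite -ulimD; [|exact: bnd_jlim..]; congr ulim; apply/funext => m.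
by rewrite IH//; exact: bnd2_cons.
Qed.

Lemma jlimB k psi chi : bnd2 psi -> bnd2 chi ->
  jlim k (fun N M => psi N M - chi N M) = jlim k psi - jlim k chi.
Proof.
elim: k psi chi => [|k IH] psi chi bpsi bchi //=.
rewrite -ulimB; [|exact: bnd_ulim_jlim..]; congr ulim; apply/funext => n.
rewrite -ulimB; [|exact: bnd_jlim..]; congr ulim; apply/funext => m.
by rewrite IH//; exact: bnd2_cons.
Qed.

Lemma jlimM k psi chi : bnd2 psi -> bnd2 chi ->
  jlim k (fun N M => psi N M * chi N M) = jlim k psi * jlim k chi.
Proof.
elim: k psi chi => [|k IH] psi chi bpsi bchi //=.
rewrite -ulimM; [|exact: bnd_ulim_jlim..]; congr ulim; apply/funext => n.
rewrite -ulimM; [|exact: bnd_jlim..]; congr ulim; apply/funext => m.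
by rewrite IH//; exact: bnd2_cons.
Qed.

Lemma jlim_cst k (c : R) : jlim k (fun _ _ => c) = c.
Proof.
elim: k => [//|k IH] /=; rewrite -[RHS](@ulim_cst _ _ U); congr ulim.
by apply/funext => n; rewrite -[RHS](@ulim_cst _ _ U) IH.
Qed.

Lemma jlim_sum (I : Type) (r : seq I) k (psi : I -> seq nat -> seq nat -> R) :
  (forall i, bnd2 (psi i)) ->
  jlim k (fun N M => \sum_(i <- r) psi i N M) = \sum_(i <- r) jlim k (psi i).
Proof.
move=> h; elim: r => [|i r IH].
  rewrite big_nil -[RHS](jlim_cst k); congr jlim.
  by apply/funext => N; apply/funext => M; rewrite big_nil.
rewrite big_cons -IH -jlimD//; last exact: bnd2_sum.
by congr jlim; apply/funext => N; apply/funext => M; rewrite big_cons.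
Qed.

Definition interleave (N M : seq nat) : seq nat :=
  flatten [seq [:: p.1; p.2] | p <- zip N M].

(** Almost every choice of the next index exceeds the previous one, so only strictly increasing
    interleavings matter, above any prescribed start [x]. *)
Lemma jlim_ge k psi c x : bnd2 psi ->
  (forall N M, size N = k -> size M = k -> path ltn x (interleave N M) ->
    c <= psi N M) ->
  c <= jlim k psi.
Proof.
elim: k psi x => [|k IH] psi x bpsi h /=; first exact: h.
apply: ulim_ge; first exact: bnd_ulim_jlim.
apply: filterS (Uinf x) => n /= xn; apply: ulim_ge; first exact: bnd_jlim.
apply: filterS (Uinf n) => m /= nm; apply: (IH _ m); first exact: bnd2_cons.
by move=> N M sN sM p; apply: h; rewrite /= ?sN ?sM// xn nm.
Qed.

Lemma jlim_le k psi c x : bnd2 psi ->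
  (forall N M, size N = k -> size M = k -> path ltn x (interleave N M) ->
    psi N M <= c) ->
  jlim k psi <= c.
Proof.
move=> bpsi h; rewrite -subr_ge0 -(jlim_cst k c) -jlimB//; last first.
  by exists `|c|.
apply: (@jlim_ge _ _ _ x) => [|N M sN sM p]; last by rewrite subr_ge0 h.
by apply: bnd2B => //; exists `|c|.
Qed.

(* The limit of the sum of [f m] along the branch [g] up to a height lying between
   [m_j] and [m_(j+1)]; this is made precise by [jlim_path_sum]. *)
Fixpoint zeta k j (f : seq nat -> tree -> R) {struct j} : branch -> R :=
  match j, k with
  | 0, _ => branch_sum U (ilim k f)
  | j'.+1, k'.+1 =>
      fun g => ulim U (fun m => zeta k' j' (fun s => f (m :: s)) g)
  | _, _ => fun=> 0
  end.

(* The vector Z_(j+1) in l2 of the branches. *)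
Definition increment k j f g := zeta k j.+1 f g - zeta k j f g.

(* The limit of the value of [phi n] at a node of the branch [g] whose height lies
   between [n_(j+1)] and [n_(j+2)]. *)
Fixpoint mean_bdry k j (phi : seq nat -> tree -> R) : branch -> R :=
  match k, j with
  | 0, _ => fun=> 0
  | k'.+1, 0 => fun g => ulim U (fun n => bdry U (ilim k' (fun s => phi (n :: s))) g)
  | k'.+1, j'.+1 => fun g => ulim U (fun n => mean_bdry k' j' (fun s => phi (n :: s)) g)
  end.

Lemma ilim_in_dual B k (phi : seq nat -> tree -> R) : 0 <= B ->
  (forall s, in_dual B (phi s)) -> in_dual B (ilim k phi).
Proof.
move=> B0; elim: k phi => [|k IH] phi phiB /=; first exact: phiB.
by apply: (@in_dual_ulim _ _ U _ B (fun n => ilim k (fun s => phi (n :: s)))) => // n; exact: IH.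
Qed.

Lemma ilim_jtb C k (f : seq nat -> tree -> R) : 0 <= C ->
  (forall s, jtb C (f s)) -> jtb C (ilim k f).
Proof.
move=> C0; elim: k f => [|k IH] f fC /=; first exact: fC.
by apply: (@jtb_ulim _ _ U _ C (fun n => ilim k (fun s => f (n :: s)))) => // n; exact: IH.
Qed.

Lemma mean_bdry_sqb B k j phi : 0 <= B -> (forall s, in_dual B (phi s)) ->
  sqb B (mean_bdry k j phi).
Proof.
move=> B0; elim: k j phi => [|k IH] [|j] phi phiB /=.
- by move=> A; rewrite big1 ?sqr_ge0// => i _; rewrite expr0n.
- by move=> A; rewrite big1 ?sqr_ge0// => i _; rewrite expr0n.
- apply: (@sqb_ulim _ _ _ U _ B (fun n => bdry U (ilim k (fun s => phi (n :: s))))) => // n.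
  by apply: bdry_sqb => //; exact: ilim_in_dual.
- apply: (@sqb_ulim _ _ _ U _ B (fun n => mean_bdry k j (fun s => phi (n :: s)))) => // n.
  exact: IH.
Qed.

Section Family.
Variables (C : R) (C0 : 0 <= C).

Lemma zeta_bound k j f g : (forall s, jtb C (f s)) -> `|zeta k j f g| <= C.
Proof.
elim: j k f => [|j IH] [|k] f fC /=; last 2 first.
- by rewrite normr0.
- by apply: ulim_norm => m; exact: IH.
- by apply: branch_sum_bound => //; exact: fC.
- by apply: branch_sum_bound => //; exact: (ilim_jtb k.+1 C0 fC).
Qed.

Lemma increment0 k f : increment k.+1 0 f =
  jump U (fun m => ilim k (fun s => f (m :: s))).
Proof. by []. Qed.

Lemma incrementS k j f : (forall s, jtb C (f s)) -> increment k.+1 j.+1 f =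
  (fun g => ulim U (fun m => increment k j (fun s => f (m :: s)) g)).
Proof.
move=> fC; apply/funext => g; rewrite /increment ulimB//.
  by exists C => m; exact: zeta_bound.
by exists C => m; exact: zeta_bound.
Qed.

Lemma increment_sqb k j f : (forall s, jtb C (f s)) -> (j < k)%N ->
  sqb C (increment k j f).
Proof.
elim: k j f => [//|k IH] [|j] f fC jk.
  by rewrite increment0; apply: jump_sqb => // m; exact: ilim_jtb.
rewrite incrementS//.
apply: (@sqb_ulim _ _ _ U _ C (fun m => increment k j (fun s => f (m :: s)))) => // m.
exact: IH.
Qed.

Section MainFormula.
Variable V : set_system {fset branch}.
Context {VU : UltraFilter V}.
Hypothesis Vsub : forall A : {fset branch}, V [set B | A `<=` B]%fset.

(** Induction peels off the outermost pair. With [n] fixed, the limit in [m] costs one boundary term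
    ([tpair_jump]), which becomes the summand of index 0. In the remaining l2 terms only one factor
    depends on [m], so [pair_ulim] applies. The limit in [n] then costs nothing ([tpair_ulim],
    [pair_ulim]). *)
Lemma jlim_tpair k phi f : (forall s, in_dual 1 (phi s)) ->
  (forall s, jtb C (f s)) ->
  jlim k (fun N M => tpair U (phi N) (f M)) = tpair U (ilim k phi) (ilim k f) +
    \sum_(j < k) l2_pair V (mean_bdry k j phi) (increment k j f).
Proof.
elim: k phi f => [|k IH] phi f phi1 fC; first by rewrite big_ord0 addr0.
rewrite [LHS]/=.
pose Phi n := ilim k (fun s => phi (n :: s)).
pose F m := ilim k (fun s => f (m :: s)).
have Phi1 n : in_dual 1 (Phi n) by exact: ilim_in_dual.
have FC m : jtb C (F m) by exact: ilim_jtb.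
have FlC : jtb C (fun t => ulim U (F^~ t)) by exact: jtb_ulim.
have JC : sqb C (jump U F) by exact: jump_sqb.
have e1 j n : sqb 1 (mean_bdry k j (fun s => phi (n :: s))) by exact: mean_bdry_sqb.
have iC (j : 'I_k) m : sqb C (increment k j (fun s => f (m :: s))).
  exact: increment_sqb.
have iSC (j : 'I_k) : sqb C (increment k.+1 j.+1 f).
  by apply: increment_sqb; rewrite ?ltnS.
have b1 n : bnd (fun m => tpair U (Phi n) (F m)).
  by exists (1 * C) => m; exact: tpair_bound.
have b2 n (j : 'I_k) : bnd (fun m => l2_pair V (mean_bdry k j (fun s => phi (n :: s)))
    (increment k j (fun s => f (m :: s)))).
  by exists (1 * C) => m; exact: pair_norm.
have inner n : ulim U (fun m => jlim k (fun N M =>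
      tpair U (phi (n :: N)) (f (m :: M)))) =
    tpair U (Phi n) (fun t => ulim U (F^~ t)) + l2_pair V (bdry U (Phi n)) (jump U F) +
    \sum_(j < k) l2_pair V (mean_bdry k j (fun s => phi (n :: s))) (increment k.+1 j.+1 f).
  under eq_fun do rewrite IH//.
  rewrite ulimD; [|exact: (b1 n)|by apply: bnd_sum => j _; exact: b2].
  rewrite (tpair_jump Uinf Vsub C0 FC (Phi1 n)); congr (_ + _).
  rewrite ulim_sum//; apply: eq_bigr => j _.
  rewrite incrementS// pairC -(pair_ulim Vsub C0 ler01)//.
  by congr ulim; apply/funext => m; rewrite pairC.
rewrite (funext inner).
have b3 : bnd (fun n => tpair U (Phi n) (fun t => ulim U (F^~ t))).
  by exists (1 * C) => n; exact: tpair_bound.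
have b4 : bnd (fun n => l2_pair V (bdry U (Phi n)) (jump U F)).
  by exists (1 * C) => n; apply: pair_norm => //; exact: bdry_sqb.
have b5 (j : 'I_k) : bnd (fun n => l2_pair V (mean_bdry k j (fun s => phi (n :: s)))
    (increment k.+1 j.+1 f)).
  by exists (1 * C) => n; exact: pair_norm.
rewrite ulimD//; [|exact: bndD|exact: bnd_sum].
rewrite ulimD// (tpair_ulim Uinf ler01 C0)// -addrA; congr (_ + _).
rewrite big_ord_recl increment0; congr (_ + _).
  by rewrite (pair_ulim Vsub ler01 C0)// => n; exact: bdry_sqb.
rewrite ulim_sum//; apply: eq_bigr => j _.
by rewrite (pair_ulim Vsub ler01 C0).
Qed.

End MainFormula.

Lemma jlim_path_sum_cst k f g h : (forall s, jtb C (f s)) ->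
  jlim k (fun _ M => path_sum (f M) g h) = path_sum (ilim k f) g h.
Proof.
elim: k f => [//|k IH] f fC /=.
rewrite -[RHS](@ulim_cst _ _ U); congr ulim; apply/funext => n.
under eq_fun do rewrite IH//.
rewrite (@path_sum_ulim _ _ _ C (fun m => ilim k (fun s => f (m :: s))))// => m.
exact: ilim_jtb.
Qed.

Lemma jlim_path_sum k j f g : (forall s, jtb C (f s)) -> (j < k)%N ->
  jlim k (fun H M => path_sum (f M) g (nth 0%N H j)) = zeta k j f g.
Proof.
elim: k j f => [//|k IH] [|j] f fC jk.
  rewrite /= /branch_sum; congr ulim; apply/funext => h.
  under eq_fun do rewrite (jlim_path_sum_cst k g h)//.
  rewrite (@path_sum_ulim _ _ _ C (fun m => ilim k (fun s => f (m :: s))))// => m.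
  exact: ilim_jtb.
rewrite /= -[RHS](@ulim_cst _ _ U); congr ulim; apply/funext => h.
by under eq_fun do rewrite IH//.
Qed.

End Family.

Lemma ilim_mask (I : Type) sigma (f : seq nat -> I -> R) :
  ilim (size sigma) (fun s => f (mask sigma s)) = ilim (count id sigma) f.
Proof.
elim: sigma f => [//|[] sigma IH] f /=; apply/funext => i.
  congr ulim; apply/funext => n.
  by rewrite (IH (fun s => f (n :: s))).
by rewrite (IH f) ulim_cst.
Qed.

Lemma zeta_mask sigma j f : (j <= size sigma)%N ->
  zeta (size sigma) j (fun s => f (mask sigma s)) =
  zeta (count id sigma) (count id (take j sigma)) f.
Proof.
elim: sigma j f => [|b sigma IH] [|j] f js //.
  by rewrite -[RHS]/(branch_sum U (ilim (count id (b :: sigma)) f)) -ilim_mask.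
apply/funext => g; case: b js => /= js.
  by congr ulim; apply/funext => m; rewrite (IH _ (fun s => f (m :: s))).
by rewrite (IH _ f)// ulim_cst.
Qed.

(** The limit in a coordinate that the mask drops is the limit of a constant: nothing jumps there,
    and the kept coordinates are only renumbered. *)
Lemma increment_mask sigma j f : (j < size sigma)%N ->
  increment (size sigma) j (fun s => f (mask sigma s)) =
  if nth false sigma j
  then increment (count id sigma) (count id (take j sigma)) f else fun=> 0.
Proof.
move=> js; apply/funext => g; rewrite /increment !zeta_mask// ?(ltnW js)//.
rewrite (take_nth false)// -cats1 count_cat/= addn0.
by case: nth => /=; rewrite ?addn1// addn0 subrr.
Qed.

End IteratedLimits.

(** * Energy of the increments *)

Fixpoint altmask (b : bool) k : bitseq :=
  if k is k'.+1 then b :: ~~ b :: altmask b k' else [::].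

Lemma size_altmask b k : size (altmask b k) = k.*2.
Proof. by elim: k => //= k ->. Qed.

Lemma count_altmask b k : count id (altmask b k) = k.
Proof. by elim: k => //= k ->; case: b. Qed.

Lemma count_take_altmask b k j : (j <= k)%N ->
  count id (take j.*2 (altmask b k)) = j.
Proof. by elim: k j => [|k IH] [|j] //= jk; rewrite IH//; case: (b). Qed.

Lemma nth_altmask b k j : (j < k)%N -> nth false (altmask b k) j.*2 = b.
Proof. by elim: k j => [|k IH] [|j] //= jk; rewrite IH. Qed.

Lemma interleave_altmask k M : size M = k.*2 ->
  interleave (mask (altmask true k) M) (mask (altmask false k) M) = M.
Proof.
elim: k M => [|k IH] [|m [|n M]] //= [sM].
by rewrite /interleave/= -/(interleave _ _) IH.
Qed.

Lemma subseq_interleave N M N' M' sigma : size N = size M ->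
  N' = mask sigma N -> M' = mask sigma M ->
  subseq (interleave N' M') (interleave N M).
Proof.
move=> + -> ->; elim: N M sigma => [|n N IH] [|m M] [|[] sigma] // [sNM].
- change (subseq (n :: m :: interleave (mask sigma N) (mask sigma M))
    (n :: m :: interleave N M)).
  by rewrite /= !eqxx; exact: IH.
- change (subseq (interleave (mask sigma N) (mask sigma M))
    ([:: n; m] ++ interleave N M)).
  exact: subseq_trans (IH _ _ sNM) (suffix_subseq _ _).
Qed.

Lemma interleave_subseql N M : size N = size M -> subseq N (interleave N M).
Proof.
elim: N M => [|n N IH] [|m M] // [sNM].
change (subseq ([:: n] ++ N) ([:: n; m] ++ interleave N M)).
by apply: cat_subseq (IH _ sNM); rewrite /= eqxx.
Qed.

Lemma interleave_subseqr N M : size N = size M -> subseq M (interleave N M).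
Proof.
elim: N M => [|n N IH] [|m M] // [sNM].
change (subseq ([:: m] ++ M) ([:: n; m] ++ interleave N M)).
by apply: cat_subseq (IH _ sNM); rewrite (suffix_subseq [:: n]).
Qed.

(** Used as [gapmask (a + s) s r] and [gapmask a s (s + r)]: the two subtuples share their first [a]
    and last [r] entries and take adjacent runs of [s] entries in between. *)
Definition gapmask p s r : bitseq := nseq p true ++ nseq s false ++ nseq r true.

Lemma size_gapmask p s r : size (gapmask p s r) = (p + (s + r))%N.
Proof. by rewrite !size_cat !size_nseq. Qed.

Lemma count_gapmask p s r : count id (gapmask p s r) = (p + r)%N.
Proof. by rewrite !count_cat !count_nseq/= !mul1n mul0n. Qed.

Lemma nth_gapmask p s r j : nth false (gapmask p s r) j =
  ((j < p) || (p + s <= j < p + (s + r)))%N.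
Proof.
rewrite /gapmask !nth_cat !size_nseq !nth_nseq.
by repeat case: ifP; lia.
Qed.

Lemma count_take_gapmask p s r j : (j <= p + (s + r))%N ->
  count id (take j (gapmask p s r)) = (minn j p + (j - (p + s)))%N.
Proof.
move=> jK; rewrite /gapmask !take_cat !size_nseq.
have tn n i (b : bool) : take i (nseq n b) = nseq (minn i n) b.
  case: (leqP i n) => h; first exact: take_nseq.
  by rewrite take_oversize// size_nseq ltnW.
case: ifP => h1; first by rewrite tn count_nseq/=; lia.
rewrite count_cat count_nseq/=; case: ifP => h2.
  by rewrite tn count_nseq/=; lia.
by rewrite count_cat tn !count_nseq/=; lia.
Qed.

Section Energy.
Variables (R : realType) (U : set_system nat) (V : set_system {fset branch}).
Context {UU : UltraFilter U} {VU : UltraFilter V}.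
Hypothesis Uinf : forall n, U [set m | (n < m)%N].
Hypothesis Vsub : forall A : {fset branch}, V [set B | A `<=` B]%fset.

Let UP : ProperFilter U := ultra_proper.
Local Existing Instance UP.

Variables (k : nat) (f : seq nat -> tree -> R) (C w : R).
Hypotheses (C0 : 0 <= C) (fC : forall s, jtb C (f s)) (w0 : 0 <= w).
Hypothesis lip : forall N M, size N = k -> size M = k ->
  sorted ltn (interleave N M) -> jtb w (fun t => f N t - f M t).

(* Apply the Lipschitz bound to the two halves of [M], cut out by the alternating
   masks: between the heights [H_(2j)] and [H_(2j+1)] only the first half has a
   coordinate. *)
Lemma increment_energy (A : {fset branch}) :
  \sum_(j < k) \sum_(g <- A) increment U k j f g ^+ 2 <= w ^+ 2.
Proof.
pose fm b s := f (mask (altmask b k) s).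
have fmC b s : jtb C (fm b s) by exact: fC.
pose P b g i (H M : seq nat) := path_sum (fm b M) g (nth 0%N H i).
have bP b g i : bnd2 (P b g i) by exists C => H M; exact: jtb_path_sum.
have jP b g i : (i < k.*2)%N -> jlim U k.*2 (P b g i) = zeta U k.*2 i (fm b) g.
  by move=> ik; exact: (jlim_path_sum C0 g (fmC b)).
pose psi (j : 'I_k) g H M := (P true g j.*2.+1 H M - P true g j.*2 H M) -
  (P false g j.*2.+1 H M - P false g j.*2 H M).
have bpsi j g : bnd2 (psi j g) by apply: bnd2B; exact: bnd2B.
have jpsi j g : jlim U k.*2 (psi j g) = increment U k j f g.
  have jk1 : (j.*2.+1 < k.*2)%N by rewrite ltn_Sdouble.
  have jk : (j.*2 < k.*2)%N by rewrite ltn_double.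
  rewrite jlimB ?jlimB ?jP//; [|exact: bnd2B..].
  rewrite -!/(increment _ _ _ _ _).
  have E b : increment U k.*2 j.*2 (fm b) =
      if b then increment U k j f else fun=> 0.
    have := @increment_mask _ U _ (altmask b k) j.*2 f.
    rewrite size_altmask count_altmask nth_altmask// count_take_altmask; last first.
      exact: ltnW.
    exact.
  by rewrite !E subr0.
rewrite (eq_bigr (fun j => jlim U k.*2 (fun H M =>
    \sum_(g <- A) (psi j g H M * psi j g H M)))); last first.
  move=> j _; rewrite jlim_sum => [|g]; last exact: bnd2M.
  by apply: eq_bigr => g _; rewrite jlimM// jpsi expr2.
rewrite -jlim_sum => [|j]; last by apply: bnd2_sum => g; exact: bnd2M.
have [hA sA] := split_by_ex A.
apply: (jlim_le Uinf (x := hA)).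
  by apply: bnd2_sum => j; apply: bnd2_sum => g; exact: bnd2M.
move=> H M sH sM p.
have sHM : size H = size M by rewrite sH.
have pH : path ltn hA H := subseq_path ltn_trans (interleave_subseql sHM) p.
have pM : path ltn hA M := subseq_path ltn_trans (interleave_subseqr sHM) p.
pose D t := fm true M t - fm false M t.
have Dw : jtb w D.
  apply: lip; rewrite ?size_mask ?size_altmask ?count_altmask//.
  by rewrite interleave_altmask//; exact: path_sorted pM.
have Hmono i i' : (i < i' < k.*2)%N -> (nth 0 H i < nth 0 H i')%N.
  move=> /andP[ii' i'k]; have := sorted_ltn_nth ltn_trans 0%N (path_sorted pH).
  by apply; rewrite ?inE ?sH// (ltn_trans ii').
(* Path sums include their last level, hence both successors. The windows are disjoint because [H]
   increases strictly. *)
apply: le_trans (@jtb_windows _ w D A k (fun j => (nth 0%N H j.*2).+1)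
  (fun j => (nth 0%N H j.*2.+1).+1) Dw _ _).
- apply: ler_sum => j _; apply: ler_sum => g _; rewrite -path_sumB.
    rewrite -expr2 le_eqVlt; apply/orP; left; apply/eqP; congr (_ ^+ 2).
    rewrite /psi /P /path_sum /D !sumrB. ring.
  have jj : (j.*2 < j.*2.+1 < k.*2)%N by rewrite ltnSn ltn_Sdouble ltn_ord.
  exact: ltnW (Hmono _ _ jj).
- move=> j; apply: split_byW sA; apply: leqW; apply: ltnW.
  have /allP := order_path_min ltn_trans pH; apply; apply: mem_nth.
  by rewrite sH ltn_double.
- move=> j j' i /andP[aj jb] /andP[aj' j'b].
  have H1 (l l' : 'I_k) : (nth 0%N H l.*2 < i)%N -> (i < (nth 0%N H l'.*2.+1).+1)%N ->
      ~~ (l' < l)%N.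
    move=> h1 h2; apply/negP => l'l.
    have := Hmono l'.*2.+1 l.*2; rewrite ltn_Sdouble l'l ltn_double ltn_ord.
    by move=> /(_ isT); lia.
  by apply/val_inj => /=; have := H1 _ _ aj j'b; have := H1 _ _ aj' jb; lia.
Qed.

Let nrm j : R := Num.sqrt (l2_pair V (increment U k j f) (increment U k j f)).

Let incC j : (j < k)%N -> sqb C (increment U k j f).
Proof. exact: increment_sqb. Qed.

Lemma increment_norm_energy : \sum_(j < k) nrm j ^+ 2 <= w ^+ 2.
Proof.
have VP : ProperFilter V := ultra_proper.
have bp (j : 'I_k) : bnd (fun A : {fset branch} =>
    \sum_(g <- A) increment U k j f g * increment U k j f g).
  by exists (C * C); apply: pair_bnd => //; exact: incC.
rewrite (eq_bigr (fun j : 'I_k =>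
    l2_pair V (increment U k j f) (increment U k j f))); last first.
  move=> j _; rewrite sqr_sqrtr//; apply: ulim_ge => //.
  by apply: nearW => A; apply: sumr_ge0 => g _; rewrite -expr2 sqr_ge0.
rewrite -ulim_sum//; apply: ulim_le; first exact: bnd_sum.
apply: nearW => A; exact: increment_energy.
Qed.

(** The [s] blocks share the energy [w ^+ 2]. By Cauchy-Schwarz a block sum above [w] forces more
    than [w ^+ 2 / s] into that block, which cannot happen in all of them. *)
Lemma small_block s : k = (s * s)%N -> (0 < s)%N ->
  exists2 b, (b < s)%N & \sum_(b * s <= j < b.+1 * s) nrm j <= w.
Proof.
move=> ks s0; apply: contrapT => nb.
have big b : (b < s)%N -> w ^+ 2 < s%:R * \sum_(b * s <= j < b.+1 * s) nrm j ^+ 2.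
  move=> bs; have : w < \sum_(b * s <= j < b.+1 * s) nrm j.
    by rewrite ltNge; apply/negP => h; apply: nb; exists b.
  move=> h; apply: (@lt_le_trans _ _ ((\sum_(b * s <= j < b.+1 * s) nrm j) ^+ 2)).
    by rewrite ltr_pXn2r// nnegrE// ltW// (le_lt_trans w0).
  have E : \sum_(b * s <= i < b.+1 * s) (1 : R) ^+ 2 = s%:R.
    by under eq_bigr do rewrite expr1n; rewrite sumr_const_nat mulSn addnK.
  have := cauchy_schwarz_seq (index_iota (b * s) (b.+1 * s)) (fun=> 1) nrm.
  by rewrite E; under eq_bigr do rewrite mul1r.
have := increment_norm_energy.
rewrite -(big_mkord xpredT (fun j => nrm j ^+ 2)) ks big_nat_mul.
rewrite -(ler_pM2l (_ : 0 < s%:R)) ?ltr0n// mulr_sumr; apply/negP; rewrite -ltNge.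
have -> : s%:R * w ^+ 2 = \sum_(0 <= b < s) w ^+ 2.
  by rewrite sumr_const_nat subn0 mulr_natl.
by apply: ltr_sum_nat => // i /andP[_ /big].
Qed.

(** * The effect of changing one block of coordinates *)

Lemma in_dual0 : in_dual 1 (fun=> 0 : R).
Proof.
exists (fun=> 0), (fun _ _ => false); split=> //.
by move=> A; rewrite big1 ?sqr_ge0// => i _; rewrite expr0n.
Qed.

(* Both masks of [N] are moved to interlacing tuples [M] without changing the
   functional [phi N]; the limit of the resulting pairing is given by
   [jlim_tpair], where only the increments inside the block do not cancel. *)
Lemma block_change a s r kappa : k = (a + s + r)%N ->
  (forall N, size N = (k + s)%N -> sorted ltn N -> exists2 phi, in_dual 1 phi &
    kappa <= tpair U phi (fun t =>
      f (mask (gapmask (a + s) s r) N) t - f (mask (gapmask a s (s + r)) N) t)) ->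
  kappa <= w *+ 2 + (\sum_(a <= j < a + s) nrm j) *+ 2.
Proof.
move=> kE hk; set K := (k + s)%N.
pose s1 := gapmask (a + s) s r; pose s2 := gapmask a s (s + r).
have K1 : size s1 = K by rewrite size_gapmask /K kE; lia.
have K2 : size s2 = K by rewrite size_gapmask /K kE; lia.
have c1 : count id s1 = k by rewrite count_gapmask kE.
have c2 : count id s2 = k by rewrite count_gapmask kE; lia.
pose f1 N := f (mask s1 N); pose f2 N := f (mask s2 N).
pose D N t := f1 N t - f2 N t.
(* Iterated limits need [phi] on all sequences; 0 serves off the increasing ones, which alone decide
   the bound. *)
have /choice[phi phiP] : forall N, exists phi, in_dual 1 phi /\
    (size N = K -> sorted ltn N -> kappa <= tpair U phi (D N)).
  move=> N; have [[sN oN]|nN] := pselect (size N = K /\ sorted ltn N).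
    by have [phi phi1 h] := hk _ sN oN; exists phi.
  by exists (fun=> 0); split=> [|sN oN]; [exact: in_dual0|case: nN].
have phi1 N : in_dual 1 (phi N) by have [] := phiP N.
have f1C N : jtb C (f1 N) by exact: fC.
have f2C N : jtb C (f2 N) by exact: fC.
have bt g : (forall N, jtb C (g N)) -> bnd2 (fun N M => tpair U (phi N) (g M)).
  by move=> gC; exists (1 * C) => N M; exact: tpair_bound.
have tD N M : tpair U (phi N) (D M) =
    tpair U (phi N) (f1 M) - tpair U (phi N) (f2 M).
  exact: (tpairBr ler01 C0 C0).
have lower : kappa - w *+ 2 <= jlim U K (fun N M => tpair U (phi N) (D M)).
  apply: (jlim_ge Uinf (x := 0%N)).
    rewrite (_ : (fun N M => _) = (fun N M => tpair U (phi N) (f1 M) -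
      tpair U (phi N) (f2 M))); first by apply: bnd2B; exact: bt.
    by apply/funext => N; apply/funext => M.
  move=> N M sN sM p; have sNM : size N = size M by rewrite sN.
  have oNM : sorted ltn (interleave N M) := path_sorted p.
  have oN : sorted ltn N := subseq_sorted ltn_trans (interleave_subseql sNM) oNM.
  have lipm sigma : size sigma = K -> count id sigma = k ->
      jtb w (fun t => f (mask sigma N) t - f (mask sigma M) t).
    move=> sK sk; apply: lip; [by rewrite size_mask ?sN|by rewrite size_mask ?sM|].
    have sub := @subseq_interleave N M _ _ sigma sNM erefl erefl.
    exact: (subseq_sorted ltn_trans sub oNM).
  have DC P : jtb (C + C) (D P) by exact: jtbB.
  have := @tpair_bound _ U _ _ _ _ _ ler01 (addr_ge0 w0 w0) (phi1 N)
    (jtbB w0 w0 (lipm _ K1 c1) (lipm _ K2 c2)).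
  rewrite (_ : (fun t => _) = (fun t => D N t - D M t)); last first.
    by apply/funext => t; rewrite /D /f1 /f2; ring.
  rewrite (tpairBr ler01 (addr_ge0 C0 C0) (addr_ge0 C0 C0) (phi1 N) (DC N) (DC M)).
  rewrite mul1r -mulr2n => h; have [_ /(_ sN oN) h1] := phiP N.
  have h2 := le_trans (ler_norm _) (h UU).
  by rewrite lerBlDr (le_trans h1)// -lerBlDl.
suff upper : jlim U K (fun N M => tpair U (phi N) (D M)) <=
    (\sum_(a <= j < a + s) nrm j) *+ 2.
  by rewrite addrC -lerBlDr (le_trans lower).
rewrite (_ : (fun N M => _) = (fun N M => tpair U (phi N) (f1 M) -
  tpair U (phi N) (f2 M))); last by apply/funext => N; apply/funext => M.
rewrite jlimB; [|exact: bt..].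
rewrite !(jlim_tpair Uinf C0 Vsub)//.
(* Limits in dropped coordinates are void, so both sides are the [k]-fold limit of [f]. *)
have il : ilim U K f1 = ilim U K f2.
  by rewrite -{1}K1 -K2 !ilim_mask c1 c2.
rewrite il opprD addrACA subrr add0r -sumrB.
(* Position [j] belongs only to [f1] in the first run and only to [f2] in the second, where the
   increments of the same block reappear shifted by [s]. Elsewhere the terms cancel or vanish, so
   the block is counted twice. *)
pose G j : R := if (a <= j < a + s)%N then nrm j else
  if (a + s <= j < a + s + s)%N then nrm (j - s) else 0.
have mean1 j : sqb 1 (mean_bdry U K j phi) by exact: mean_bdry_sqb.
have pz y : l2_pair V y (fun=> 0) = 0 :> R.
  apply: ulim_near_cst; have VP : ProperFilter V := ultra_proper.
  by apply: nearW => A; rewrite big1// => g _; rewrite mulr0.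
have bound (j : 'I_K) : l2_pair V (mean_bdry U K j phi) (increment U K j f1) -
    l2_pair V (mean_bdry U K j phi) (increment U K j f2) <= G j.
  have jK : (j < k + s)%N := ltn_ord j.
  have E1 := @increment_mask _ U _ s1 j f; rewrite K1 c1 in E1.
  have E2 := @increment_mask _ U _ s2 j f; rewrite K2 c2 in E2.
  rewrite E1// E2// !nth_gapmask !count_take_gapmask; [|lia..].
  rewrite /G.
  have cs y l : (l < k)%N -> sqb 1 y -> `|l2_pair V y (increment U k l f)| <= nrm l.
    by move=> lk y1; exact: (pair_sqr_le C0 y1 (incC lk)).
  have [ja|aj] := boolP (j < a)%N.
    have -> : (j < a + s)%N by lia.
    have -> /= : (minn j (a + s) + (j - (a + s + s)))%N = j by lia.
    have -> : (minn j a + (j - (a + s)))%N = j by lia.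
    have -> : (a <= j)%N = false by lia.
    have -> : (a + s <= j)%N = false by lia.
    by rewrite subrr.
  have [jas|asj] := boolP (j < a + s)%N.
    have -> : (a <= j)%N by lia.
    have -> : (a + s <= j)%N = false by lia.
    rewrite /= pz subr0.
    have -> : (minn j (a + s) + (j - (a + s + s)))%N = j by lia.
    by apply: le_trans (ler_norm _) (cs _ _ _ _) => //; lia.
  have [jass|assj] := boolP (j < a + s + s)%N.
    have -> : (a + s <= j)%N by lia.
    have -> : (a + s + s <= j)%N = false by lia.
    have -> /= : (j < a + (s + (s + r)))%N by lia.
    rewrite andbF pz sub0r.
    have -> : (minn j a + (j - (a + s)))%N = (j - s)%N by lia.
    apply: le_trans (ler_norm _) _; rewrite normrN; apply: cs => //; lia.
  have -> : (a + s <= j)%N by lia.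
  have -> : (a + s + s <= j)%N by lia.
  have -> : (j < a + s + (s + r))%N by lia.
  have -> /= : (j < a + (s + (s + r)))%N by lia.
  have -> : (minn j (a + s) + (j - (a + s + s)))%N = (j - s)%N by lia.
  have -> : (minn j a + (j - (a + s)))%N = (j - s)%N by lia.
  by rewrite andbF subrr.
apply: le_trans (ler_sum _ (fun j _ => bound j)) _.
rewrite -(big_mkord xpredT G).
rewrite (big_cat_nat (n := a))//=; last by rewrite /K; lia.
rewrite big_nat_cond big1 => [|j]; last first.
  by rewrite /G => /andP[/andP[_ ja] _]; repeat case: ifP => //; lia.
rewrite add0r (big_cat_nat (n := (a + s)%N))//=; [|lia|by rewrite /K; lia].
rewrite (big_cat_nat (n := (a + s + s)%N) (m := (a + s)%N))//=;
  [|lia|by rewrite /K; lia].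
rewrite [X in _ + (_ + X)]big_nat_cond [X in _ + (_ + X)]big1 => [|j]; last first.
  by rewrite /G => /andP[/andP[j1 _] _]; repeat case: ifP => //; lia.
rewrite addr0 mulr2n lerD//.
  by rewrite le_eqVlt; apply/orP; left; apply/eqP; apply: eq_big_nat => j jas;
    rewrite /G jas.
rewrite big_addn addnK.
rewrite le_eqVlt; apply/orP; left; apply/eqP; apply: eq_big_nat => j jas.
rewrite /G; have -> : (a <= j + s < a + s)%N = false by lia.
have -> : (a + s <= j + s < a + s + s)%N by lia.
by rewrite addnK.
Qed.

End Energy.

(** * Kalton graphs *)

Section KaltonGraphs.
Implicit Types (n m N M : seq nat).

(** Pairs x <= y with y < t contribute equally. At the first pair with t <= y only x may count, and
    all later entries are at least t. So the count is 1-Lipschitz for the graph metric, whence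
    [kalton_dist_ge]. *)
Lemma interlaced_count t n m : size n = size m -> interlaced n m ->
  (count (fun i => i < t) m <= count (fun i => i < t) n
    <= (count (fun i => i < t) m).+1)%N.
Proof.
rewrite /interlaced -/(interleave n m).
elim: n m => [|x n IH] [|y m] // [snm].
change (interleave (x :: n) (y :: m)) with ([:: x, y & interleave n m]).
move=> /= /andP[xy p]; have [yt|ty] := ltnP y t.
  by rewrite (leq_ltn_trans xy yt) !add1n !ltnS; apply: IH => //; exact: path_sorted p.
have /allP h := order_path_min leq_trans p.
have c0 l : subseq l (interleave n m) -> count (fun i => i < t)%N l = 0%N.
  move=> /mem_subseq sl; apply/eqP; rewrite -leqn0 leqNgt -has_count.
  by apply/hasPn => i /sl /h yi; rewrite -leqNgt (leq_trans ty).
by rewrite !c0 ?interleave_subseql ?interleave_subseqr// !addn0 leq_b1.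
Qed.

Lemma kalton_dist_ge k (n m : kvertex k.+1) t :
  (count (fun i => i < t) (val (val n)) <=
   count (fun i => i < t) (val (val m)) + kalton_dist n m)%N.
Proof.
rewrite /kalton_dist; case: ex_minnP => l /asboolP[p [np <-] <-] _.
elim: p n np {l m} => [|v p IH] n /=; first by rewrite addn0.
move=> /andP[/andP[_ nv] /IH h]; rewrite addnS.
apply: leq_trans (_ : (count (fun i => i < t) (val (val v))).+1 <= _)%N; last by rewrite ltnS.
have snv : size (val (val n)) = size (val (val v)) by rewrite !size_tuple.
by case/orP: nv => /interlaced_count => [/(_ t snv)|/(_ t (esym snv))] /andP[h1 h2];
  rewrite // (leq_trans h1).
Qed.

Lemma kalton_dist_interlaced k (n m : kvertex k.+1) :
  interlaced (val (val n)) (val (val m)) -> (kalton_dist n m <= 1)%N.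
Proof.
move=> nm; rewrite /kalton_dist; case: ex_minnP => l _ lmin.
have [E|nEm] := eqVneq n m.
  by rewrite (leq_trans (lmin 0%N _))//; apply/asboolP; exists [::].
apply: lmin; apply/asboolP; exists [:: m] => //; split=> //=.
by rewrite /kalton_edge nEm nm.
Qed.

Lemma mask_gapmask p s r N : size N = (p + (s + r))%N ->
  mask (gapmask p s r) N = take p N ++ drop (p + s) N.
Proof.
move=> sN; rewrite -{1}(cat_take_drop p N) /gapmask.
rewrite mask_cat ?size_nseq ?size_takel//; last by rewrite sN leq_addr.
rewrite mask_true ?size_take_min ?geq_minl//; congr (_ ++ _).
rewrite -{1}(cat_take_drop s (drop p N)) mask_cat; last first.
  by rewrite size_nseq size_takel// size_drop sN addKn leq_addr.
by rewrite mask_false mask_true ?drop_drop// addnC// !size_drop sN; lia.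
Qed.

(** The threshold is the first entry of the second run: one subtuple has [a + s] entries below it,
    the other at most [a]. *)
Lemma count_gapmask_diff a s r N : size N = (a + s + (s + r))%N -> (0 < s)%N ->
  sorted ltn N ->
  (count (fun i => i < nth 0 N (a + s)) (mask (gapmask a s (s + r)) N) + s <=
   count (fun i => i < nth 0 N (a + s)) (mask (gapmask (a + s) s r) N))%N.
Proof.
move=> sN s0 oN; set t := nth 0%N N (a + s).
rewrite !mask_gapmask ?sN//; last by lia.
have small i : i \in take (a + s) N -> (i < t)%N.
  move=> /(nthP 0%N)[j]; rewrite size_takel ?sN ?leq_addr// => ja <-.
  rewrite nth_take//; apply: (sorted_ltn_nth ltn_trans) => //; rewrite inE sN; lia.
have large i : i \in drop (a + s) N -> (t <= i)%N.
  move=> /(nthP 0%N)[j]; rewrite size_drop sN => ja <-.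
  rewrite nth_drop; have [->|j0] := posnP j; first by rewrite addn0.
  apply: ltnW; apply: (sorted_ltn_nth ltn_trans) => //; rewrite ?inE ?sN; lia.
rewrite !count_cat.
have -> : count (fun i => i < t)%N (drop (a + s) N) = 0%N.
  apply/eqP; rewrite -leqn0 leqNgt -has_count.
  by apply/hasPn => i /large; rewrite -leqNgt.
have -> : count (fun i => i < t)%N (take (a + s) N) = (a + s)%N.
  rewrite (eq_in_count (a2 := predT)) => [|i /small ->//].
  by rewrite count_predT size_takel// sN leq_addr.
have := count_size (fun i => i < t)%N (take a N).
rewrite size_takel ?sN; lia.
Qed.

Variable R : realType.

(** Dropping the first entry and appending a larger one is an interlacing move. After [k] such moves
    both tuples reach [iota M k]. *)
Lemma interlaced_diameter (E : normedModType R) k (f : seq nat -> E) (w : R) :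
  (forall n m, size n = k -> size m = k -> sorted ltn n -> sorted ltn m ->
    interlaced n m -> `|f n - f m| <= w) ->
  forall n, size n = k -> sorted ltn n -> `|f n - f (iota 0 k)| <= w *+ k *+ 2.
Proof.
move=> fw.
have step n (M : nat) j : (j <= k)%N -> size n = k -> sorted ltn n ->
    (forall i, i \in n -> (i < M)%N) ->
    `|f n - f (drop j n ++ iota M j)| <= w *+ j.
  move=> + sn on nM; elim: j => [_|j IH jk].
    by rewrite drop0 cats0 subrr normr0.
  have so i : (i <= k)%N -> size (drop i n ++ iota M i) = k.
    by move=> ik; rewrite size_cat size_drop size_iota sn subnK.
  have oo i : sorted ltn (drop i n ++ iota M i).
    rewrite (sorted_pairwise ltn_trans) pairwise_cat
      -!(sorted_pairwise ltn_trans).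
    apply/and3P; split; last exact: iota_ltn_sorted.
      apply/allrelP => a b /mem_drop/nM aM; rewrite mem_iota => /andP[Mb _].
      exact: leq_trans aM Mb.
    exact: drop_sorted.
  rewrite mulrSr (le_trans (ler_distD (f (drop j n ++ iota M j)) _ _))// lerD//.
    by apply: IH; exact: ltnW.
  apply: fw; rewrite ?so ?oo// 1?ltnW//.
  have bd i : i \in drop j n ++ iota M j -> (i < M + j)%N.
    rewrite mem_cat mem_iota => /orP[/mem_drop/nM|/andP[]//].
    by move=> iM; rewrite ltn_addr.
  have -> : drop j.+1 n ++ iota M j.+1 =
      rcons (behead (drop j n ++ iota M j)) (M + j).
    by rewrite -[in iota _ _](addn1 j) iotaD cats1 -rcons_cat [drop j n](drop_nth 0%N) ?sn.
  have := oo j; have := so j (ltnW jk); move: bd.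
  case: (drop j n ++ iota M j) => [|x r] bd sr xr; first by rewrite -sr in jk.
  apply: interlaced_shift; last by apply/ltnW/bd; exact: mem_last.
  by apply: sub_path xr => a b; exact: ltnW.
move=> n sn on; pose M := (\max_(i <- n ++ iota 0 k) i).+1.
have inM i : i \in n ++ iota 0 k -> (i < M)%N.
  by move=> il; rewrite ltnS; exact: (@leq_bigmax_seq _ _ xpredT id).
have nM i : i \in n -> (i < M)%N by move=> il; apply: inM; rewrite mem_cat il.
have kM i : i \in iota 0 k -> (i < M)%N.
  by move=> il; apply: inM; rewrite mem_cat il orbT.
have h1 := step n M k (leqnn k) sn on nM.
have h2 := step (iota 0 k) M k (leqnn k) (size_iota _ _) (iota_ltn_sorted _ _) kM.
rewrite !drop_oversize ?size_iota ?sn// in h1 h2.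
rewrite (le_trans (ler_distD (f (iota M k)) _ _))// mulr2n lerD//.
by rewrite distrC.
Qed.

End KaltonGraphs.

(* [k] stands for the graph on (k+1)-tuples, so that all positive lengths, and
   only those, occur in the family. *)
Theorem corollary32 (R : realType) (JT : completeNormedModType R)
    (iota : {linear c00 R -> JT}) (hJT : is_completion iota) :
  ~ equi_coarsely_embeds
      (fun (k : nat) (n m : kvertex k.+1) => (kalton_dist n m)%:R : R)
      (fun x y : JT => `|x - y|).
Proof.
move=> [rho [omega [Phi [pos mono rho_oo H]]]].
have [iso dns] := hJT.
have [U [UU Uinf]] := nat_ultra.
have [V [VV Vsub]] := fset_ultra branch.
(* The bound across an edge, plus an error of at most 1 at each endpoint from replacing the map by
   finitely supported functions. *)
pose w := omega 1 + 2.
have om0 : 0 <= omega 1 by have [] := pos 1 ler01.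
have w0 : 0 <= w by rewrite addr_ge0.
(* [w *+ 4] is the bound of [block_change] for a block sum of at most [w]. Of the 3, 2 pays for the
   approximation and 1 for a norm that need not be attained by a family of segments. *)
have [s s0 rs] : exists2 s : nat, (0 < s)%N & w *+ 4 + 3 < rho s%:R.
  have /pinfty_ex_gt0[x x0 hx] : \forall t \near +oo, w *+ 4 + 3 < rho t.
    by move/cvgryPgt: rho_oo; exact.
  exists (Num.truncn x).+1 => //; apply: lt_le_trans hx _.
  have [] // := mono x (Num.truncn x).+1%:R (ltW x0) _.
  by rewrite ltW// truncnS_gt.
pose K := (s * s).-1.
have KE : K.+1 = (s * s)%N by rewrite prednK// muln_gt0 s0.
have approx (y : JT) : exists x : c00 R, `|iota x - y| < 1.
  have [|z [hz [x _ xz]]] := dns (ball y 1) _ (ball_open y 1).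
    by exists y; exact: ballxx.
  by exists x; rewrite distrC xz; move: hz; rewrite -ball_normE.
(* The limits also run through sequences that are not vertices, where [f] is 0. *)
have /choice[f fP] : forall n : seq nat, exists x : c00 R,
    (forall v : kvertex K.+1, val (val v) = n -> `|iota x - Phi K v| < 1) /\
    ((forall v : kvertex K.+1, val (val v) <> n) -> x = 0).
  move=> n; have [[v vn]|nv] := pselect (exists v : kvertex K.+1, val (val v) = n).
    have [x xP] := approx (Phi K v); exists x; split=> [u un|/(_ v)//].
    by rewrite (_ : u = v)//; apply/val_inj/val_inj; rewrite un vn.
  by exists 0; split=> // v vn; case: nv; exists v.
have vertex n : size n = K.+1 -> sorted ltn n ->
    exists v : kvertex K.+1, val (val v) = n.
  move=> /eqP sn on.
  by exists (exist (fun t : K.+1.-tuple nat => sorted ltn t) (Tuple sn) on).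
have fPhi n m (u v : kvertex K.+1) : val (val u) = n -> val (val v) = m ->
    `| `|f n - f m| - `|Phi K u - Phi K v| | <= 2.
  move=> un vm; rewrite -iso linearB (le_trans (ler_dist_dist _ _))//.
  rewrite (_ : _ - _ = (iota (f n) - Phi K u) - (iota (f m) - Phi K v)); last first.
    by rewrite !opprD !opprK addrACA.
  have [/(_ _ un)/ltW h1 _] := fP n; have [/(_ _ vm)/ltW h2 _] := fP m.
  by rewrite (le_trans (ler_normB _ _))// -[2]/(1 + 1) lerD.
have fint n m : size n = K.+1 -> size m = K.+1 -> sorted ltn n -> sorted ltn m ->
    interlaced n m -> `|f n - f m| <= w.
  move=> sn sm on om nm.
  have [u un] := vertex n sn on; have [v vm] := vertex m sm om.
  have /andP[_ h] := H K u v.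
  have d1 : (kalton_dist u v <= 1)%N.
    by apply: kalton_dist_interlaced; rewrite un vm.
  have [|_ h'] := mono (kalton_dist u v)%:R 1 (ler0n _ _) _.
    by rewrite lern1.
  have := fPhi n m u v un vm; rewrite ler_distl => /andP[_ h2].
  apply: le_trans h2 _; rewrite /w lerD2r.
  exact: le_trans h h'.
(* [C] grows with [s], but it only ensures that the limits exist and does not enter the final
   estimate. *)
pose C := `|f (seq.iota 0 K.+1)| + w *+ K.+1 *+ 2.
have C0 : 0 <= C by rewrite addr_ge0// !mulrn_wge0.
have fC n : jtb C (f n : tree -> R).
  apply: jtb_jt_norm; first exact: jt_bounded_c00.
  have [[v vn]|nv] := pselect (exists v : kvertex K.+1, val (val v) = n).
    have sn : size n = K.+1 by rewrite -vn size_tuple.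
    have on : sorted ltn n by rewrite -vn; exact: (valP v).
    have := interlaced_diameter fint sn on.
    move=> /(lerD (lexx `|f (seq.iota 0 K.+1)|)); apply: le_trans.
    by rewrite -[leLHS]/`|f n| addrC -lerBlDr; exact: lerB_dist.
  have [_ ->] := fP n; first by rewrite -[leLHS]/`|0 : c00 R| normr0.
  by move=> v vn; apply: nv; exists v.
have lip N M : size N = K.+1 -> size M = K.+1 -> sorted ltn (interleave N M) ->
    jtb w (fun t => (f N : tree -> R) t - (f M : tree -> R) t).
  move=> sN sM oNM; have sNM : size N = size M by rewrite sN.
  apply: (jtb_jt_norm (jt_bounded_c00 (f N - f M))).
  apply: fint => //.
  - exact: (subseq_sorted ltn_trans (interleave_subseql sNM) oNM).
  - exact: (subseq_sorted ltn_trans (interleave_subseqr sNM) oNM).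
  - by apply: sub_sorted oNM => a b; exact: ltnW.
have [b bs small] := small_block (V := V) Uinf C0 fC w0 lip KE s0.
have asr : K.+1 = (b * s + s + (K.+1 - b.+1 * s))%N.
  by rewrite -mulSnr subnKC// KE leq_mul2r bs orbT.
have := block_change (V := V) (kappa := rho s%:R - 3) Uinf Vsub C0 fC w0 lip asr.
rewrite -mulSnr => /(_ UU VV) h; have {}h : rho s%:R - 3 <= w *+ 2 + w *+ 2.
  apply: le_trans (h _) _; last by rewrite lerD2l ler_wMn2r.
  move=> N sN oN; set r := (K.+1 - b.+1 * s)%N in asr *.
  set N1 := mask _ N; set N2 := mask _ N.
  have sK1 : size (gapmask (b.+1 * s) s r) = size N.
    by rewrite size_gapmask sN; rewrite /r; lia.
  have sK2 : size (gapmask (b * s) s (s + r)) = size N.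
    by rewrite size_gapmask sN; rewrite /r; lia.
  have sN1 : size N1 = K.+1 by rewrite size_mask// count_gapmask; lia.
  have sN2 : size N2 = K.+1 by rewrite size_mask// count_gapmask; lia.
  have oN1 : sorted ltn N1 := sorted_mask ltn_trans _ oN.
  have oN2 : sorted ltn N2 := sorted_mask ltn_trans _ oN.
  have [u uN1] := vertex N1 sN1 oN1; have [v vN2] := vertex N2 sN2 oN2.
  have dist : (s <= kalton_dist u v)%N.
    have := @kalton_dist_ge K u v (nth 0%N N (b * s + s)).
    have := @count_gapmask_diff (b * s) s r N.
    rewrite uN1 vN2 -mulSnr -/N1 -/N2 sN => /(_ _ s0 oN); lia.
  have norm : rho s%:R - 2 <= `|f N1 - f N2|.
    have /andP[h1 _] := H K u v.
    have [|h2 _] := mono s%:R (kalton_dist u v)%:R (ler0n _ _) _.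
      by rewrite ler_nat.
    have := fPhi N1 N2 u v uN1 vN2; rewrite ler_distl => /andP[h3 _].
    by apply: le_trans h3; rewrite lerB// (le_trans h2).
  have r3 : 0 <= rho s%:R - 3.
    by rewrite subr_ge0 ltW// (le_lt_trans _ rs)// lerDr mulrn_wge0.
  have [k [S [sS dS hS]]] : exists k (S : 'I_k -> set tree),
      [/\ forall j, segment (S j), trivIset setT S &
       rho s%:R - 3 < jt_sum (f N1 - f N2) S].
    apply: contrapT => nS.
    have : `|f N1 - f N2| <= rho s%:R - 3.
      apply: jt_norm_le => k S sS dS; rewrite leNgt; apply/negP => hS.
      by apply: nS; exists k, S.
    by apply/negP; rewrite -ltNge (lt_le_trans _ norm)// ltrD2l ltrN2 ltr_nat.
  have [phi phi1 phiE] := in_dual_norming Uinf sS dS (le_lt_trans r3 hS).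
  exists phi => //; apply: le_trans (ltW hS) _.
  by rewrite -phiE.
by move: rs; rewrite -ltrBrDr ltNge (le_trans h)// -mulrnDr.
Qed.
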